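(* Let $n\ge1$, let $\widetilde{X}$ be a regular $\mathbb{Z}^n$ covering of a finite simplicial complex $X$, and assume that the $L^2$-Betti number $b^{(2)}_q(\widetilde{X};\mathbb{Z}^n)$ is $0$. Then there is a constant $C>0$ such that for every finite cover $X'=\widetilde{X}/\Gamma'$ of $X$ (with $\Gamma'\le\mathbb{Z}^n$ a subgroup of finite index), $$b_q(X')\le C\,\frac{[\mathbb{Z}^n:\Gamma']}{\mathrm{short}(\Gamma')}.$$
   Context: $\mathbb{Z}^n$ acts freely and simplicially on $\widetilde{X}$ with quotient $X$. $b_q$ is the ordinary $q$-th Betti number. $b^{(2)}_q(\widetilde{X};\mathbb{Z}^n)$ is the von Neumann dimension of the kernel of the combinatorial Laplacian on the space of $\ell^2$ $q$-cochains of $\widetilde{X}$; its vanishing means there are no nonzero $L^2$ harmonic $q$-cochains. $\mathbb{Z}^n$ carries the word metric of a fixed finite generating set, and $\mathrm{short}(\Gamma')$ is the word length of the shortest non-identity element of $\Gamma'$. $C$ does not depend on $\Gamma'$. *)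

(* Defs.v *)
From HB Require Import structures.
From mathcomp Require Import all_boot all_order all_algebra finmap.
From mathcomp Require Import all_classical all_reals.
From mathcomp Require Import ereal esum.

Set Implicit Arguments.
Unset Strict Implicit.
Unset Printing Implicit Defensive.

Import Order.TTheory GRing.Theory Num.Theory.
Local Open Scope classical_set_scope.
Local Open Scope ring_scope.

(* An abstract simplicial complex whose vertex set is all of V. *)
Record simplicial_complex (V : choiceType) := SimplicialComplex {
  simplex :> {fset V} -> Prop;
  simplex_neq0 : ~ simplex fset0;
  simplex_vertex : forall v, simplex [fset v]%fset;
  simplex_face : forall s t : {fset V},
    simplex s -> (t `<=` s)%fset -> t != fset0 -> simplex t }.

(* Simplices are graded by their number of vertices, so that the q-simplices
   are [faces K q.+1]; [faces K 0] is empty, i.e., the complex is not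
   augmented. *)
Definition faces (V : choiceType) (K : simplicial_complex V) (k : nat) :
  set {fset V} := [set s | K s /\ #|` s|%fset = k].

(* Simplices are oriented by a numbering [o] of the vertices that is injective
   on each simplex.  If s is the face of t opposite to v, the incidence number
   [t : s] is (-1)^i, where v is the i-th vertex of t (counted from 0) in the
   order of their numbers; otherwise it is 0. *)
Definition incidence (R : pzRingType) (V : choiceType) (o : V -> nat)
    (t s : {fset V}) : R :=
  \sum_(v <- enum_fset t | (t `\ v)%fset == s)
     (-1) ^+ #|` [fset u in t | (o u < o v)%N]|%fset.

Section OrdinaryBetti.
Variables (V : finType) (K : simplicial_complex V).

Definition vertex_rank (v : V) : nat := enum_rank v.

Definition face_pred (k : nat) : {pred {fset V}} := mem (faces K k).

(* Matrix of the boundary map from rational q-chains to (q-1)-chains, acting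
   on row vectors. *)
Definition boundary_mx (q : nat) :
    'M[rat]_(#|face_pred q.+1|, #|face_pred q|) :=
  \matrix_(i, j) incidence rat vertex_rank (enum_val i) (enum_val j).

(* dim H_q = dim Z_q - dim B_q *)
Definition betti (q : nat) : nat :=
  (\rank (kermx (boundary_mx q)) - \rank (boundary_mx q.+1))%N.

End OrdinaryBetti.

Section Coverings.
Variable n : nat.

Definition act_simplex (W : choiceType) (act : 'rV[int]_n -> W -> W)
    (g : 'rV[int]_n) (s : {fset W}) : {fset W} := [fset act g x | x in s]%fset.

(* Freeness refers to the geometric realization: an element fixing a simplex
   setwise fixes its barycenter. *)
Record free_simplicial_action (W : choiceType) (Xt : simplicial_complex W)
    (act : 'rV[int]_n -> W -> W) : Prop := FreeSimplicialAction {
  act_id : forall x, act 0 x = x;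
  act_comp : forall g h x, act (g + h) x = act g (act h x);
  act_simplicial : forall g s, Xt s -> Xt (act_simplex act g s);
  act_free : forall g s, Xt s -> act_simplex act g s = s -> g = 0 }.

(* The simplicial map p exhibits X as the quotient of Xt by the subgroup G,
   that is, it induces an isomorphism from Xt / G to X. *)
Record quotient_map (W V : choiceType) (Xt : simplicial_complex W)
    (act : 'rV[int]_n -> W -> W) (G : {pred 'rV[int]_n})
    (X : simplicial_complex V) (p : W -> V) : Prop := QuotientMap {
  quot_simplicial : forall s, Xt s -> X [fset p x | x in s]%fset;
  quot_inj : forall s, Xt s -> {in s &, injective p};
  quot_surj : forall t, X t -> exists2 s, Xt s & [fset p x | x in s]%fset = t;
  quot_fiber : forall s s', Xt s -> Xt s' ->
    ([fset p x | x in s]%fset = [fset p x | x in s']%fset <->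
     exists2 g, g \in G & s' = act_simplex act g s) }.

Definition cosets (G : {pred 'rV[int]_n}) : set (set 'rV[int]_n) :=
  range (fun x => [set x + g | g in [set` G]]).

Definition finite_index (G : {pred 'rV[int]_n}) : Prop := finite_set (cosets G).

Definition subgroup_index (G : {pred 'rV[int]_n}) : nat :=
  #|` fset_set (cosets G)|%fset.

End Coverings.

Section WordMetric.
Variables (n : nat) (S : seq 'rV[int]_n).

Definition is_word (k : nat) (g : 'rV[int]_n) : Prop :=
  exists w : k.-tuple 'rV[int]_n,
    (forall x, x \in w -> x \in S \/ - x \in S) /\ g = \sum_(x <- w) x.

Definition generates : Prop := forall g, exists k, is_word k g.

(* The least element of A, or 0 if A is empty. *)
Definition least (A : set nat) : nat :=
  xget 0%N [set k | A k /\ forall j, A j -> (k <= j)%N].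

Definition word_length (g : 'rV[int]_n) : nat := least [set k | is_word k g].

Definition short (G : {pred 'rV[int]_n}) : nat :=
  least [set word_length g | g in [set g | g \in G /\ g != 0]].

End WordMetric.

Section Hilbert.
Variables (R : realType) (T : choiceType).
Implicit Types f h : T -> R.

(* The real Hilbert space of l^2 functions on S, as functions on T that vanish
   outside S. *)
Definition l2 (S : set T) : set (T -> R) :=
  [set f | (forall t, ~ S t -> f t = 0) /\
           summable [set: T] (fun t => (f t ^+ 2)%:E)].

(* The absolutely convergent sum of the f t * h t, for f and h in l^2. *)
Definition inner f h : R :=
  fine (\esum_(t in [set: T]) (Num.max (f t * h t) 0)%:E) -
  fine (\esum_(t in [set: T]) (Num.max (- (f t * h t)) 0)%:E).

(* Orthogonal projection of f to a closed subspace H of l^2. *)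
Definition orth_proj (H : set (T -> R)) f : T -> R :=
  xget (fun=> 0) [set h | H h /\
    forall k, H k -> inner (fun t => f t - h t) k = 0].

Definition dirac_fun (t0 : T) : T -> R := fun t => (t == t0)%:R.

End Hilbert.

Section L2Betti.
Variables (R : realType) (n : nat) (W : choiceType).
Variables (Xt : simplicial_complex W) (act : 'rV[int]_n -> W -> W).
Variable o : W -> nat.
Implicit Types f : {fset W} -> R.

(* [coboundary k] maps a cochain on [faces Xt k] to one on [faces Xt k.+1];
   [codifferential k], which goes the other way, is its l^2 adjoint.  All sums
   are finite, since Xt is locally finite when its quotient is finite. *)
Definition coboundary (k : nat) f : {fset W} -> R :=
  fun t => \sum_(s \in faces Xt k) incidence R o t s * f s.

Definition codifferential (k : nat) f : {fset W} -> R :=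
  fun s => \sum_(t \in faces Xt k.+1) incidence R o t s * f t.

Definition laplacian (q : nat) f : {fset W} -> R := fun s =>
  codifferential q.+1 (coboundary q.+1 f) s +
  coboundary q (codifferential q f) s.

Definition l2_harmonic (q : nat) : set ({fset W} -> R) :=
  [set f | l2 (faces Xt q.+1) f /\
           forall s, faces Xt q.+1 s -> laplacian q f s = 0].

Definition orbits (S : set {fset W}) : set (set {fset W}) :=
  [set [set act_simplex act g s | g in [set: 'rV[int]_n]] | s in S].

(* For a free action on S with finitely many orbits, l^2(S) is the sum of
   copies of l^2(Z^n) given by a choice of one simplex s in each orbit, and the
   von Neumann dimension of an invariant closed subspace H is the von Neumann
   trace of the orthogonal projection P to H, the sum of the <P s, s>. *)
Definition vn_dim (S : set {fset W}) (H : set ({fset W} -> R)) : R :=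
  \sum_(O \in orbits S)
    let s := xget fset0 O in
    inner (orth_proj H (dirac_fun R s)) (dirac_fun R s).

Definition l2_betti (q : nat) : R := vn_dim (faces Xt q.+1) (l2_harmonic q).

End L2Betti.

(* Main.v *)
Require Import Defs.
From mathcomp Require Import all_boot all_order all_algebra finmap.
From mathcomp Require Import all_classical all_reals.
From mathcomp Require Import ereal numfun esum zify ring lra.

Set Implicit Arguments.
Unset Strict Implicit.
Unset Printing Implicit Defensive.

Import Order.TTheory GRing.Theory Num.Theory.
Local Open Scope classical_set_scope.
Local Open Scope ring_scope.

(* If the L^2-Betti number vanishes, no nonzero finitely supported q-cochain of
   the covering is harmonic: a nonzero value of a harmonic cochain at a simplex
   s makes the projection of the Dirac function at s nonzero.  So the Laplacian,
   which has some propagation d, embeds the cochains supported in a box of side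
   L - 2d into those supported in a box of side L.  Harmonic cochains of X'
   pulled back to the covering are annihilated by the image, and hence their
   restrictions to a box of side L span a space of dimension
   O(L^n - (L - 2d)^n) = O(L^(n-1)).  Let r be the dimension of the space of
   harmonic cochains of X', and choose r simplices whose evaluations form a basis
   of its dual.  At most O(L^(n-1)) of them meet the image of a given box, while
   each of them meets the images of at least L^n of the [Z^n : G] translates of a
   box, as soon as the box embeds in Z^n / G.  Thus r L = O([Z^n : G]), and L can
   be taken proportional to short(G).  Finally b_q(X') <= r. *)

(** * Square-summable functions *)

Section SquareSummable.
Context {R : realType} {T : choiceType}.
Implicit Types (u v : T -> R) (f h k : T -> R) (c : R).

Definition asummable u := summable [set: T] (fun t => (u t)%:E).

(** The signed sum inside [inner], isolated so that linearity can be proved for one function at a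
    time. *)
Definition real_sum u : R :=
  fine (\esum_(t in [set: T]) (Num.max (u t) 0)%:E) -
  fine (\esum_(t in [set: T]) (Num.max (- u t) 0)%:E).

Lemma inner_real_sum f h : inner f h = real_sum (fun t => f t * h t).
Proof. by []. Qed.

Lemma asummable_le u v : (forall t, `|u t| <= `|v t|) -> asummable v ->
  asummable u.
Proof.
move=> uv; apply: le_lt_trans; apply: le_esum => t _.
by rewrite /= lee_fin.
Qed.

Lemma asummableD u v : asummable u -> asummable v ->
  asummable (fun t => u t + v t).
Proof. by move=> su sv; have := summableD su sv. Qed.

Lemma ge0_esumZl c u : 0 <= c -> (forall t, 0 <= u t) ->
  \esum_(t in [set: T]) (c * u t)%:E = (c%:E * \esum_(t in [set: T]) (u t)%:E)%E.
Proof.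
move=> c0 u0.
have le_scale (d : R) (w : T -> R) : 0 <= d -> (forall t, 0 <= w t) ->
    (\esum_(t in [set: T]) (d * w t)%:E <= d%:E * \esum_(t in [set: T]) (w t)%:E)%E.
  move=> d0 w0; apply: ge_ereal_sup => _ [A [finA _] <-].
  rewrite fsbig_finite//= (eq_bigr (fun t => d%:E * (w t)%:E)%E)//.
  rewrite -ge0_sume_distrr; last by move=> t _; rewrite lee_fin.
  apply: lee_wpmul2l; first by rewrite lee_fin.
  by apply: esum_ge; exists A => //; rewrite fsbig_finite.
move: c0; rewrite le_eqVlt => /predU1P[<-|c0].
  by rewrite mul0e esum1// => t _; rewrite mul0r.
apply/eqP; rewrite eq_le; apply/andP; split; first exact: le_scale (ltW c0) u0.
rewrite -lee_pdivlMl//.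
(* The converse inequality is the same one for the factor 1/c. *)
have := le_scale c^-1 (fun t => c * u t).
rewrite invr_ge0 (ltW c0) => /(_ isT (fun t => mulr_ge0 (ltW c0) (u0 t))).
by apply: le_trans; apply: le_esum => t _; rewrite mulrA mulVf ?gt_eqF// mul1r.
Qed.

Lemma asummableZ c u : asummable u -> asummable (fun t => c * u t).
Proof.
move=> su; rewrite /asummable /summable.
under eq_esum do rewrite /= normrM.
rewrite ge0_esumZl//; have := su; rewrite /asummable summableE => /fineK <-.
exact: ltry.
Qed.

Let max0 (x : R) : 0 <= Num.max x 0. Proof. by rewrite le_max lexx orbT. Qed.
Hint Resolve max0 : core.

Lemma max0_sub (x : R) : Num.max x 0 - Num.max (- x) 0 = x.
Proof. by rewrite /Num.max; case: ltP => ?; case: ltP => ?; lra. Qed.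

Lemma asummableN u : asummable u -> asummable (fun t => - u t).
Proof. by apply: asummable_le => t; rewrite normrN. Qed.

Lemma asummable_max0 u : asummable u -> asummable (fun t => Num.max (u t) 0).
Proof.
by apply: asummable_le => t; rewrite ger0_norm// ge_max ler_norm normr_ge0.
Qed.

Lemma asummable_max0_fin u : asummable u ->
  \esum_(t in [set: T]) (Num.max (u t) 0)%:E \is a fin_num.
Proof.
move=> /asummable_max0; rewrite /asummable summableE.
by under eq_esum do rewrite /= ger0_norm//.
Qed.

(** Any such decomposition may replace the one into positive and negative parts. Linearity then
    follows by adding or scaling the parts, which a negative factor exchanges. *)
Lemma real_sumB (a b u : T -> R) : (forall t, 0 <= a t) -> (forall t, 0 <= b t) ->
  asummable a -> asummable b -> (forall t, u t = a t - b t) ->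
  real_sum u = fine (\esum_(t in [set: T]) (a t)%:E) -
               fine (\esum_(t in [set: T]) (b t)%:E).
Proof.
move=> a0 b0 sa sb uab.
have fin (w : T -> R) : (forall t, 0 <= w t) -> asummable w ->
    \esum_(t in [set: T]) (w t)%:E \is a fin_num.
  move=> w0; rewrite /asummable summableE.
  by under eq_esum do rewrite /= ger0_norm//.
have su : asummable u.
  apply: asummable_le (asummableD sa sb) => t.
  by rewrite uab [leRHS]ger0_norm ?addr_ge0// ler_norml; have := a0 t; have := b0 t; lra.
have := @esumB R T [set: T] (fun t => (a t)%:E) (fun t => (b t)%:E) sa sb
  (fun t _ => a0 t) (fun t _ => b0 t).
under eq_esum do rewrite funeposE -EFinB -uab -EFin_max.
under [X in (_ - X)%E]eq_esum do rewrite funenegE -EFinB -uab -EFinN -EFin_max.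
move=> /(congr1 fine); rewrite !fineB ?fin//.
- exact: asummable_max0.
- exact: asummable_max0 (asummableN su).
Qed.

Lemma real_sumD u v : asummable u -> asummable v ->
  real_sum (fun t => u t + v t) = real_sum u + real_sum v.
Proof.
move=> su sv.
rewrite (@real_sumB (fun t => Num.max (u t) 0 + Num.max (v t) 0)
  (fun t => Num.max (- u t) 0 + Num.max (- v t) 0)).
- under eq_esum do rewrite EFinD.
  under [X in _ - fine X]eq_esum do rewrite EFinD.
  by rewrite !esumD ?fineD ?asummable_max0_fin ?asummableN// /real_sum; first ring;
    move=> *; rewrite lee_fin.
- by move=> t; rewrite addr_ge0.
- by move=> t; rewrite addr_ge0.
- by apply: asummableD; apply: asummable_max0.
- by apply: asummableD; apply: asummable_max0; apply: asummableN.
- by move=> t; rewrite -[in LHS](max0_sub (u t)) -[in LHS](max0_sub (v t)); ring.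
Qed.

Lemma real_sumZ c u : asummable u -> real_sum (fun t => c * u t) = c * real_sum u.
Proof.
move=> su.
case: (leP 0 c) => c0.
  rewrite (@real_sumB (fun t => c * Num.max (u t) 0) (fun t => c * Num.max (- u t) 0)).
  - by rewrite !ge0_esumZl// !fineM ?asummable_max0_fin ?asummableN// -mulrBr.
  - by move=> t; rewrite mulr_ge0.
  - by move=> t; rewrite mulr_ge0.
  - by apply: asummableZ; apply: asummable_max0.
  - by apply: asummableZ; apply: asummable_max0; apply: asummableN.
  - by move=> t; rewrite -[in LHS](max0_sub (u t)) mulrBr.
have c0' : 0 <= - c by lra.
rewrite (@real_sumB (fun t => - c * Num.max (- u t) 0) (fun t => - c * Num.max (u t) 0)).
- by rewrite !ge0_esumZl// !fineM ?asummable_max0_fin ?asummableN// /real_sum /=; ring.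
- by move=> t; rewrite mulr_ge0.
- by move=> t; rewrite mulr_ge0.
- by apply: asummableZ; apply: asummable_max0; apply: asummableN.
- by apply: asummableZ; apply: asummable_max0.
- by move=> t; rewrite -[in LHS](max0_sub (u t)); ring.
Qed.

Lemma ge0_real_sum u : (forall t, 0 <= u t) ->
  real_sum u = fine (\esum_(t in [set: T]) (u t)%:E).
Proof.
move=> u0; rewrite /real_sum [X in _ - fine X]esum1 ?subr0.
  by congr fine; apply: eq_esum => t _; rewrite max_l.
by move=> t _; rewrite max_r// oppr_le0.
Qed.

Lemma real_sum_ge_fset (A : {fset T}) u : (forall t, 0 <= u t) -> asummable u ->
  \sum_(t <- A) u t <= real_sum u.
Proof.
move=> u0 su; rewrite ge0_real_sum// -lee_fin fineK; last first.
  by move: su; rewrite /asummable summableE; under eq_esum do rewrite /= ger0_norm//.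
rewrite -sumEFin; apply: esum_ge; exists [set` A].
  by split => //; exact: finite_fset.
by rewrite fsbig_finite// set_fsetK.
Qed.

Lemma asummable_bounded (M : R) u : (forall t, 0 <= u t) ->
  (forall A : {fset T}, \sum_(t <- A) u t <= M) ->
  asummable u /\ real_sum u <= M.
Proof.
move=> u0 uM.
have le : (\esum_(t in [set: T]) (u t)%:E <= M%:E)%E.
  apply: ge_ereal_sup => _ [A [finA _] <-].
  by rewrite fsbig_finite//= sumEFin lee_fin.
have sumu : asummable u.
  rewrite /asummable /summable; under eq_esum do rewrite /= ger0_norm//.
  exact: le_lt_trans le (ltry _).
split=> //; rewrite ge0_real_sum// -lee_fin fineK//.
by move: sumu; rewrite /asummable summableE; under eq_esum do rewrite /= ger0_norm//.
Qed.

Lemma real_sum_ge_term u t : (forall t, 0 <= u t) -> asummable u -> u t <= real_sum u.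
Proof.
by move=> u0 su; have := real_sum_ge_fset [fset t]%fset u0 su; rewrite big_seq_fset1.
Qed.

Lemma real_sum_ge0 u : (forall t, 0 <= u t) -> 0 <= real_sum u.
Proof.
by move=> u0; rewrite ge0_real_sum// fine_ge0// esum_ge0// => t _; rewrite lee_fin.
Qed.

Definition sq_summable f := asummable (fun t => f t ^+ 2).

Lemma sq_summableM f h : sq_summable f -> sq_summable h ->
  asummable (fun t => f t * h t).
Proof.
move=> sf sh; apply: asummable_le (asummableD sf sh) => t.
rewrite [leRHS]ger0_norm ?addr_ge0 ?sqr_ge0// normrM.
rewrite -(real_normK (num_real (f t))) -(real_normK (num_real (h t))).
by have := sqr_ge0 (`|f t| - `|h t|); have := sqr_ge0 (`|f t| + `|h t|); nra.
Qed.

Lemma sq_summableD f h : sq_summable f -> sq_summable h ->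
  sq_summable (fun t => f t + h t).
Proof.
move=> sf sh.
apply: asummable_le (asummableZ 2 (asummableD sf sh)) => t.
rewrite ger0_norm ?sqr_ge0// ger0_norm; last first.
  by rewrite mulr_ge0// addr_ge0// sqr_ge0.
by have := sqr_ge0 (f t - h t); nra.
Qed.

Lemma sq_summableZ c f : sq_summable f -> sq_summable (fun t => c * f t).
Proof.
by move=> sf; apply: asummable_le (asummableZ (c ^+ 2) sf) => t; rewrite exprMn.
Qed.

Lemma innerC f h : inner f h = inner h f.
Proof. by rewrite !inner_real_sum; under eq_fun do rewrite mulrC. Qed.

Lemma innerDl f h k : sq_summable f -> sq_summable h -> sq_summable k ->
  inner (fun t => f t + h t) k = inner f k + inner h k.
Proof.
move=> sf sh sk; rewrite !inner_real_sum; under eq_fun do rewrite mulrDl.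
by rewrite real_sumD//; exact: sq_summableM.
Qed.

Lemma innerZl c f k : sq_summable f -> sq_summable k ->
  inner (fun t => c * f t) k = c * inner f k.
Proof.
move=> sf sk; rewrite !inner_real_sum; under eq_fun do rewrite -mulrA.
by rewrite real_sumZ//; exact: sq_summableM.
Qed.

Lemma innerff_ge0 f : 0 <= inner f f.
Proof. by rewrite inner_real_sum real_sum_ge0// => t; rewrite -expr2 sqr_ge0. Qed.

Lemma sqr_le_innerff f t : sq_summable f -> f t ^+ 2 <= inner f f.
Proof.
move=> sf; rewrite inner_real_sum; apply: (@real_sum_ge_term (fun t => f t * f t)).
  by move=> ?; rewrite -expr2 sqr_ge0.
exact: sq_summableM.
Qed.

Lemma inner_dirac t0 f : inner (dirac_fun R t0) f = f t0.
Proof.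
rewrite inner_real_sum.
have one (c : R) : 0 <= c ->
    \esum_(t in [set: T]) (if t == t0 then c else 0)%:E = c%:E.
  move=> c0; rewrite -(esum_set1 (t := t0) (a := fun=> c%:E)) ?lee_fin//.
  rewrite [RHS]esum_mkcond; apply: eq_esum => t _.
  by rewrite in_set1; case: eqP.
rewrite /real_sum.
under eq_esum => t _.
  rewrite /dirac_fun (_ : Num.max _ _ =
    if t == t0 then Num.max (f t0) 0 else 0); last first.
    by case: eqP => [->|]; rewrite ?mul1r// mul0r maxxx.
  over.
under [X in _ - fine X]eq_esum => t _.
  rewrite /dirac_fun (_ : Num.max _ _ =
    if t == t0 then Num.max (- f t0) 0 else 0); last first.
    by case: eqP => [->|]; rewrite ?mul1r// mul0r oppr0 maxxx.
  over.
by rewrite !one//= max0_sub.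
Qed.

Lemma sq_summable_dirac t0 : sq_summable (dirac_fun R t0).
Proof.
apply: (asummable_bounded (M:=1) _ _).1 => [t|A]; first exact: sqr_ge0.
rewrite (eq_bigr (fun t => if t == t0 then 1 else 0)); last first.
  by move=> t _; rewrite /dirac_fun; case: eqP; rewrite ?expr1n ?expr0n.
rewrite -big_mkcond -big_filter.
have [tA|tA] := boolP (t0 \in A).
  by rewrite filter_pred1_uniq ?fset_uniq// big_seq1.
rewrite (@eq_in_filter _ _ pred0) ?filter_pred0 ?big_nil// => t.
by case: eqP => // ->; rewrite (negbTE tA).
Qed.

End SquareSummable.

(** * Orthogonal projections *)

Section Projection.
Context {R : realType} {T : choiceType}.
Variable H : set (T -> R).
Hypothesis H_sq : forall f, H f -> sq_summable f.
Hypothesis H_0 : H (fun=> 0).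
Hypothesis H_lin : forall (c : R) f h, H f -> H h -> H (fun t => f t + c * h t).
(** Closedness under uniform limits is stronger than closedness in l^2. It suits the pointwise
    estimates below, and harmonic cochains have it because the Laplacian is local. *)
Hypothesis H_closed : forall f, sq_summable f ->
  (forall e : R, 0 < e -> exists2 h, H h & forall t, `|f t - h t| <= e) -> H f.

Let inner_line f h (c : R) : H f -> H h ->
  inner (fun t => f t + c * h t) (fun t => f t + c * h t) =
  inner f f + 2 * c * inner f h + c ^+ 2 * inner h h.
Proof.
move=> /H_sq sf /H_sq sh.
have sch := sq_summableZ c sh.
rewrite innerDl//; last exact: sq_summableD.
rewrite innerC innerDl// [X in _ + X]innerC innerDl// (innerC f) !innerZl//.
by rewrite (innerC h (fun t => c * h t)) innerZl// (innerC h f); ring.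
Qed.

(* The infimum m of the square norm over the affine space of the h in H with
   h(t0) = 1 is attained at the supremum x of the functions h - e_h, where
   e_h = sqrt (2 (|h|^2 - m)): by the parallelogram identity
   |g - h| <= e_g + e_h pointwise, so that |x - h| <= e_h. *)
Let minimizer t0 h0 : H h0 -> h0 t0 = 1 ->
  exists x, [/\ H x, x t0 = 1 &
    forall h, H h -> h t0 = 1 -> inner x x <= inner h h].
Proof.
move=> Hh0 h01.
pose A := [set h | H h /\ h t0 = 1].
pose N := [set inner h h | h in A].
have Nlb : has_lbound N by exists 0 => _ [h _ <-]; exact: innerff_ge0.
have N0 : N !=set0 by exists (inner h0 h0), h0.
pose m := inf N.
have mA h : A h -> m <= inner h h by move=> Ah; apply: ge_inf => //; exists h.
pose e (h : T -> R) := Num.sqrt (2 * (inner h h - m)).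
have e0 h : 0 <= e h by exact: sqrtr_ge0.
have e2 h : A h -> e h ^+ 2 = 2 * (inner h h - m).
  by move=> /mA mh; rewrite sqr_sqrtr// mulr_ge0// subr_ge0.
have small (d : R) : 0 < d -> exists2 h, A h & e h <= d.
  move=> d0.
  have [_ [h Ah <-] hm] : exists2 y, N y & y < m + d ^+ 2 / 2.
    by apply: inf_adherent => //; rewrite divr_gt0// exprn_gt0.
  exists h => //; rewrite -(@ler_pXn2r _ 2) ?nnegrE ?(ltW d0)//.
  by rewrite e2//; lra.
have close g h t : A g -> A h -> `|g t - h t| <= e g + e h.
  move=> Ag Ah; have [[Hg g1] [Hh h1]] := (Ag, Ah).
  rewrite -(@ler_pXn2r _ 2) ?nnegrE ?addr_ge0// real_normK ?num_real//.
  have Hgh : H (fun t => g t + (-1) * h t) by exact: H_lin.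
  have := sqr_le_innerff t (H_sq Hgh); rewrite inner_line// => gh.
  (* The midpoint of g and h also takes the value 1 at t0, so its square norm is at least m. *)
  have Hmid : A (fun t => h t + 2^-1 * (g t + (-1) * h t)).
    by split; [exact: H_lin|rewrite g1 h1; field].
  have := mA _ Hmid; rewrite inner_line// inner_line//.
  rewrite (innerC h) innerDl; try exact: H_sq; last exact/sq_summableZ/H_sq.
  rewrite innerZl; try exact: H_sq.
  have -> : g t - h t = g t + (-1) * h t by ring.
  have := e2 _ Ag; have := e2 _ Ah; have := mulr_ge0 (e0 g) (e0 h).
  rewrite sqrrD.
  move: (inner h h) (inner g h) (inner g g) gh => hh gh gg.
  by move=> *; nra.
pose x t := sup [set h t - e h | h in A].
have x_close h t : A h -> `|x t - h t| <= e h.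
  move=> Ah.
  have ub : ubound [set h t - e h | h in A] (h t + e h).
    by move=> _ [g Ag <-]; have := close g h t Ag Ah; rewrite ler_norml; lra.
  have x_le : x t <= h t + e h by apply: ge_sup => //; exists (h t - e h), h.
  have x_ge : h t - e h <= x t.
    by apply: ub_le_sup; [exists (h t + e h)|exists h].
  by rewrite ler_norml; lra.
have x1 : x t0 = 1.
  apply/eqP; rewrite -subr_eq0 -normr_le0; apply/ler_addgt0Pl => d d0.
  have [h Ah hd] := small d d0; rewrite addr0 (le_trans _ hd)//.
  by have := x_close h t0 Ah; rewrite Ah.2.
have x_sum (F : {fset T}) : \sum_(t <- F) x t ^+ 2 <= m.
  apply/ler_addgt0Pl => d d0.
  (* With e = e_h <= 1 and |h|^2 = m + e^2/2, the bound (1 + e) |h|^2 + |F| (e + e^2) is at most m +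
     C e. *)
  pose C := m + 1 + 2 * (size F)%:R.
  have m0 : 0 <= m by apply: lb_le_inf => // _ [h _ <-]; exact: innerff_ge0.
  have C0 : 0 < C by rewrite /C; have := ler0n R (size F); lra.
  have d'0 : 0 < Num.min 1 (d / C) by rewrite lt_min ltr01 divr_gt0.
  have [h Ah] := small _ d'0; rewrite le_min => /andP[h1 hd].
  have hd' : e h * C <= d by rewrite -ler_pdivlMr.
  have bound t : x t ^+ 2 <= (1 + e h) * h t ^+ 2 + (e h + e h ^+ 2).
    have := x_close h t Ah; rewrite ler_norml => /andP[lo hi].
    have := sqr_ge0 (h t - 1); have := sqr_ge0 (h t + 1).
    by have := e0 h; nra.
  have Fh : \sum_(t <- F) h t ^+ 2 <= inner h h.
    rewrite inner_real_sum; under eq_bigr do rewrite expr2.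
    apply: real_sum_ge_fset; first by move=> t; rewrite -expr2 sqr_ge0.
    exact: (H_sq Ah.1).
  apply: (@le_trans _ _ (\sum_(t <- F) ((1 + e h) * h t ^+ 2 + (e h + e h ^+ 2)))).
    exact: ler_sum.
  rewrite big_split/= -mulr_sumr big_const_seq count_predT iter_addr_0.
  rewrite -mulr_natr; move: hd'; rewrite /C.
  have := e2 h Ah; have := e0 h; have := ler0n R (size F); have := mA h Ah.
  move: h1 Fh.
  move: (e h) (inner h h) (\sum_(t <- F) _) (size F)%:R => E I S s.
  move=> e1 SI mI s0 E0 EI EC.
  have : (1 + E) * S <= (1 + E) * I by rewrite ler_wpM2l//; lra.
  have : E ^+ 2 <= E by nra.
  by nra.
have [sx xm] : sq_summable x /\ inner x x <= m.
  rewrite inner_real_sum; under eq_fun do rewrite -expr2.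
  by apply: asummable_bounded => // t; exact: sqr_ge0.
exists x; split=> //.
  apply: H_closed => // d /small[h Ah hd]; exists h; first exact: Ah.1.
  by move=> t; exact: le_trans (x_close h t Ah) hd.
by move=> h Hh h1; apply: le_trans xm _; exact: mA.
Qed.

(** The projection of the Dirac function is the vector that represents evaluation at t0 on H. It is
    x / |x|^2, where x has least norm among the elements of H with value 1 at t0, or 0 if all of H
    vanishes at t0. *)
Lemma dirac_projection t0 : exists2 P, H P &
  forall k, H k -> inner (fun t => dirac_fun R t0 t - P t) k = 0.
Proof.
have split_dirac P k : H P -> H k ->
    inner (fun t => dirac_fun R t0 t - P t) k = k t0 - inner P k.
  move=> /H_sq sP /H_sq sk; under eq_fun do rewrite -mulN1r.
  rewrite innerDl ?inner_dirac ?innerZl//; last exact: sq_summableZ.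
  - by rewrite mulN1r.
  - exact: sq_summable_dirac.
have [all0|/existsNP[f0 /not_implyP[Hf0 f00]]] :=
    pselect (forall k, H k -> k t0 = 0).
  exists (fun=> 0) => // k Hk; rewrite split_dirac// all0// inner_real_sum.
  under eq_fun do rewrite mul0r.
  by rewrite ge0_real_sum// esum1// subr0.
pose h0 t := (f0 t0)^-1 * f0 t.
have Hh0 : H h0.
  have -> : h0 = (fun t => 0 + (f0 t0)^-1 * f0 t) by apply/funext => t; rewrite add0r.
  exact: H_lin.
have [x [Hx x1 xmin]] := @minimizer t0 h0 Hh0 (mulVf (introN eqP f00)).
have xx0 : 0 < inner x x.
  by apply: lt_le_trans (sqr_le_innerff t0 (H_sq Hx)); rewrite x1 expr1n.
have orth k : H k -> k t0 = 0 -> inner x k = 0.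
  move=> Hk k0.
  have quad (c : R) : 0 <= 2 * c * inner x k + c ^+ 2 * inner k k.
    have := @xmin (fun t => x t + c * k t) (H_lin c Hx Hk).
    by rewrite x1 k0 mulr0 addr0 => /(_ erefl); rewrite inner_line//; lra.
  have kk0 := innerff_ge0 k.
  (* The denominator |k|^2 + 1 in place of the optimal |k|^2 avoids a division by zero and still
     gives a negative value unless <x, k> = 0. *)
  have := quad (- inner x k / (inner k k + 1)).
  have d0 : inner k k + 1 != 0 by rewrite gt_eqF//; lra.
  set a := inner x k; set b := inner k k => le0.
  have : 0 <= - (a ^+ 2 * (b + 2)) / (b + 1) ^+ 2.
    by apply: le_trans le0 _; rewrite le_eqVlt; apply/orP; left; apply/eqP; field.
  rewrite pmulr_lge0 ?invr_gt0 ?exprn_gt0//; last by rewrite /b; lra.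
  move=> le1; apply/eqP; rewrite -sqrf_eq0 eq_le sqr_ge0 andbT.
  by have := sqr_ge0 a; rewrite /b in le1 *; nra.
pose P t := 0 + (inner x x)^-1 * x t.
have HP : H P by exact: H_lin.
exists P => // k Hk; rewrite split_dirac//.
have sx := H_sq Hx; have sk := H_sq Hk.
have -> : inner P k = (inner x x)^-1 * inner x k.
  have -> : P = (fun t => (inner x x)^-1 * x t).
    by apply/funext => t; rewrite /P add0r.
  exact: innerZl.
(* Subtracting k(t0) x from k leaves an element of H that vanishes at t0, hence is orthogonal to
   x. *)
have := orth (fun t => k t + (- k t0) * x t) (H_lin _ Hk Hx).
rewrite x1 mulr1 subrr => /(_ erefl).
rewrite innerC innerDl//; last exact: sq_summableZ.
rewrite innerZl// (innerC k) => /eqP; rewrite mulNr subr_eq0 => /eqP ->.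
by rewrite mulrCA mulVf ?gt_eqF// mulr1 subrr.
Qed.

(** The pairing is the square norm of the projection Q. If it is 0, so is evaluation at t0 on H,
    which Q represents. *)
Lemma inner_orth_proj_ge0 t0 :
  0 <= inner (orth_proj H (dirac_fun R t0)) (dirac_fun R t0) /\
  (inner (orth_proj H (dirac_fun R t0)) (dirac_fun R t0) = 0 ->
   forall f, H f -> f t0 = 0).
Proof.
have [P HP orthP] := dirac_projection t0.
set Q := orth_proj H _.
(* As a projection exists, [orth_proj] does not fall back on its default value. *)
have [HQ orthQ] : H Q /\ forall k, H k ->
    inner (fun t => dirac_fun R t0 t - Q t) k = 0.
  by rewrite /Q /orth_proj; case: xgetP => [h _ []//|/(_ P)[]].
have innerQ k : H k -> inner Q k = k t0.
  move=> Hk; have := orthQ _ Hk; under eq_fun do rewrite -mulN1r.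
  have sQ := H_sq HQ; have sk := H_sq Hk.
  rewrite innerDl//; [|exact: sq_summable_dirac|exact: sq_summableZ].
  by rewrite inner_dirac innerZl// mulN1r => /eqP; rewrite subr_eq0 => /eqP.
rewrite innerC inner_dirac -innerQ//; split; first exact: innerff_ge0.
move=> QQ0 f Hf; rewrite -innerQ//.
have Q0 t : Q t = 0.
  apply/eqP; rewrite -sqrf_eq0 eq_le sqr_ge0 andbT -QQ0.
  exact: sqr_le_innerff (H_sq HQ).
rewrite inner_real_sum; under eq_fun do rewrite Q0 mul0r.
by rewrite ge0_real_sum// esum1.
Qed.

End Projection.

(** * Orientations *)

Lemma imfset_sub {W V : choiceType} (f : W -> V) (s t : {fset W}) :
  (s `<=` t)%fset -> ([fset f x | x in s] `<=` [fset f x | x in t])%fset.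
Proof. by move=> st; apply: subset_imfset => x; exact: fsubsetP. Qed.

Lemma imfset_inj_sub {W V : choiceType} (f : W -> V) (t s s' : {fset W}) :
  {in t &, injective f} -> (s `<=` t)%fset -> (s' `<=` t)%fset ->
  [fset f x | x in s]%fset = [fset f x | x in s']%fset -> s = s'.
Proof.
move=> fI; wlog suff: s s' / (s `<=` t)%fset -> (s' `<=` t)%fset ->
    [fset f x | x in s]%fset = [fset f x | x in s']%fset -> (s `<=` s')%fset.
  move=> sub st s't e; apply/eqP; rewrite eqEfsubset.
  by apply/andP; split; [exact: sub|exact: sub].
move=> st s't e; apply/fsubsetP => x xs.
have : f x \in [fset f x | x in s']%fset by rewrite -e in_imfset.
move=> /imfsetP[y /= ys' fxy].
by rewrite (fI x y) ?(fsubsetP st _ xs) ?(fsubsetP s't _ ys').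
Qed.

Lemma card_fset_sum {W : choiceType} (t : {fset W}) (P : pred W) :
  #|` [fset u in t | P u]|%fset = (\sum_(u <- t) P u)%N.
Proof.
rewrite -sum1_size big_fset/= big_mkcond.
by apply: eq_bigr => u _; case: (P u).
Qed.

Section Orientation.
Context {R : realType} {W : choiceType}.
Implicit Types (o : W -> nat) (s t : {fset W}).

Lemma incidence_eq0 o t s : ~~ (s `<=` t)%fset -> incidence R o t s = 0.
Proof.
move=> st; rewrite /incidence big_seq_cond big1// => v /andP[_ /eqP tv].
by move: st; rewrite -tv fsubsetDl.
Qed.

Lemma incidence_imfset {V : choiceType} (f : W -> V) (o : V -> nat) t s :
  {in t &, injective f} -> (s `<=` t)%fset ->
  incidence R o [fset f x | x in t]%fset [fset f x | x in s]%fset =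
  incidence R (o \o f) t s.
Proof.
move=> fI st; rewrite /incidence big_mkcond big_imfset//= [RHS]big_mkcond/=.
rewrite big_seq [RHS]big_seq; apply: eq_bigr => v vt.
have -> : ([fset f x | x in t] `\ f v = [fset f x | x in t `\ v])%fset.
  apply/fsetP => y; rewrite !inE; apply/andP/imfsetP => /=.
    move=> [yv /imfsetP[/= x xt yx]]; exists x => //; rewrite !inE xt andbT.
    by apply: contra yv => /eqP <-; rewrite yx.
  move=> [x /[!inE] /andP[xv xt] ->]; split; last exact: in_imfset.
  by apply: contra xv => /eqP /fI -> //.
congr (if _ then _ else _).
  apply/eqP/eqP => [/(imfset_inj_sub fI)-> //|->//].
  exact: fsubsetDl.
congr (_ ^+ _); rewrite !card_fset_sum.
by rewrite big_imfset.
Qed.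

(** The pairs of vertices that the two numberings order oppositely; the parity is the sign of the
    permutation between the two orders of t. *)
Definition inversions o o' t : nat :=
  \sum_(v <- t) \sum_(u <- t) ((o u < o v) && (o' v < o' u))%N.

Lemma inversions_fsetD1 o o' t v : v \in t ->
  inversions o o' t = (inversions o o' (t `\ v)%fset +
    \sum_(u <- t) ((o u < o v) && (o' v < o' u)) +
    \sum_(u <- t) ((o v < o u) && (o' u < o' v)))%N.
Proof.
move=> vt; rewrite /inversions.
rewrite (big_fsetD1 v)//=.
under [X in (_ + X)%N]eq_bigr do rewrite (big_fsetD1 v)//=.
rewrite big_split/= [X in (_ + _ + X)%N](big_fsetD1 v)//= !ltnn.
by rewrite addnAC -addnA addnC; lia.
Qed.

(** The positions of v in t for the two numberings differ in parity by the number of inversions that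
    involve v, which is what t has in excess of its face without v. *)
Lemma incidence_reorient o o' t s :
  {in t &, injective o} -> {in t &, injective o'} ->
  incidence R o t s =
  (-1) ^+ inversions o o' t * (-1) ^+ inversions o o' s * incidence R o' t s.
Proof.
move=> oI o'I; rewrite /incidence mulr_sumr.
rewrite big_seq_cond [RHS]big_seq_cond; apply: eq_bigr => v /andP[vt /eqP <-].
rewrite -!exprD -signr_odd -[RHS]signr_odd; congr (_ ^+ nat_of_bool _).
rewrite (inversions_fsetD1 o o' vt) !card_fset_sum.
set I := inversions _ _ _.
(* Vertices that precede v in both orders are counted in both positions, so they do not affect the
   parity of the sum. *)
pose agree := (\sum_(u <- t) ((o u < o v) && (o' u < o' v)))%N.
suff /(congr1 odd) : (\sum_(u <- t) (o u < o v) + \sum_(u <- t) (o' u < o' v) =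
    \sum_(u <- t) ((o u < o v) && (o' v < o' u)) +
    \sum_(u <- t) ((o v < o u) && (o' u < o' v)) + (agree + agree))%N.
  by rewrite !oddD; do 6!case: (odd _).
rewrite /agree -!big_split/= big_seq [RHS]big_seq.
apply: eq_bigr => u ut; have [->|uv] := eqVneq u v; first by rewrite !ltnn.
have := contra_neq (oI u v ut vt) uv; have := contra_neq (o'I u v ut vt) uv.
by case: (ltngtP (o u) (o v)) => // _; case: (ltngtP (o' u) (o' v)).
Qed.

End Orientation.

(** * The Laplacian as a matrix *)

(** Associativity for a product of matrices with possibly infinite index sets: the finite sets C and
    N carry the nonzero coefficients. *)
Lemma fsum_swap {R : idomainType} {I J : choiceType} (D C : set I) (E N : set J)
    (a : I -> R) (b : I -> J -> R) (f : J -> R) :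
  finite_set C -> finite_set N -> C `<=` D -> N `<=` E ->
  (forall i, D i -> ~ C i -> a i = 0) ->
  (forall i j, C i -> E j -> ~ N j -> b i j = 0) ->
  \sum_(i \in D) a i * (\sum_(j \in E) b i j * f j) =
  \sum_(j <- fset_set N) (\sum_(i \in D) a i * b i j) * f j.
Proof.
move=> finC finN CD NE aC bN.
transitivity (\sum_(i \in C) \sum_(j \in N) a i * (b i j * f j)).
  rewrite -(@fsbig_widen _ _ _ _ C D) //; last first.
    by move=> i [Di nCi] /=; rewrite aC ?mul0r.
  apply: eq_fsbigr => i /set_mem Ci; rewrite mulr_fsumr.
  rewrite -(@fsbig_widen _ _ _ _ N E) // => j [Ej nNj] /=.
  by rewrite bN// mul0r mulr0.
rewrite exchange_fsbig// fsbig_finite//; apply: eq_bigr => j _.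
rewrite -(@fsbig_widen _ _ _ _ C D) //; last first.
  by move=> i [Di nCi] /=; rewrite aC ?mul0r.
by rewrite mulr_fsuml; apply: eq_fsbigr => i _; rewrite mulrA.
Qed.

Section Laplacian.
Context {R : realType} {W : choiceType} (Xt : simplicial_complex W).
Implicit Types (o : W -> nat) (s t : {fset W}) (f : {fset W} -> R).

Definition locally_finite := forall s, Xt s ->
  finite_set [set t | Xt t /\ (s `<=` t)%fset].

(** A common coface or a common face, of any dimension: outside this relation the coefficients of
    the Laplacian vanish. *)
Definition adjacent s s' := exists2 r, Xt r &
  (s `<=` r)%fset && (s' `<=` r)%fset || (r `<=` s)%fset && (r `<=` s')%fset.

Definition lap_coef o q s s' : R :=
  \sum_(t \in faces Xt q.+2) incidence R o t s * incidence R o t s' +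
  \sum_(r \in faces Xt q) incidence R o s r * incidence R o s' r.

Lemma lap_coefC o q s s' : lap_coef o q s s' = lap_coef o q s' s.
Proof.
by congr (_ + _); apply: eq_fsbigr => r _; rewrite mulrC.
Qed.

Lemma lap_coef_eq0 o q s s' : ~ adjacent s s' -> lap_coef o q s s' = 0.
Proof.
move=> nadj; rewrite /lap_coef !fsbig1 ?addr0// => r [Kr _].
  have [rs|/incidence_eq0 ->] := boolP (r `<=` s)%fset; last by rewrite mul0r.
  have [rs'|/incidence_eq0 ->] := boolP (r `<=` s')%fset; last by rewrite mulr0.
  by case: nadj; exists r; rewrite // rs rs' orbT.
have [rs|/incidence_eq0 ->] := boolP (s `<=` r)%fset; last by rewrite mul0r.
have [rs'|/incidence_eq0 ->] := boolP (s' `<=` r)%fset; last by rewrite mulr0.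
by case: nadj; exists r; rewrite // rs rs'.
Qed.

(** The sign of the intermediate simplex occurs twice and cancels, so a change of orientations
    conjugates the Laplacian by a diagonal matrix of signs. *)
Lemma lap_coef_reorient o o' q s s' :
  (forall t, Xt t -> {in t &, injective o}) ->
  (forall t, Xt t -> {in t &, injective o'}) -> Xt s -> Xt s' ->
  lap_coef o q s s' =
  (-1) ^+ inversions o o' s * (-1) ^+ inversions o o' s' * lap_coef o' q s s'.
Proof.
move=> oI o'I Ks Ks'; rewrite /lap_coef mulrDr !mulr_fsumr; congr (_ + _).
  apply: eq_fsbigr => t /set_mem[/= Kt _].
  rewrite !(@incidence_reorient R _ o o' t) //; try exact: oI; try exact: o'I.
  move: (sqrr_sign R (inversions o o' t)).
  by move: (_ ^+ inversions _ _ t) (_ ^+ inversions _ _ s)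
    (_ ^+ inversions _ _ s') => x y z x2;
    rewrite -[RHS]mul1r -x2; ring.
apply: eq_fsbigr => r /set_mem[/= Kr _].
rewrite (@incidence_reorient R _ o o' s) ?(@incidence_reorient R _ o o' s') //;
  try exact: oI; try exact: o'I.
move: (sqrr_sign R (inversions o o' r)).
by move: (_ ^+ inversions _ _ r) (_ ^+ inversions _ _ s)
    (_ ^+ inversions _ _ s') => x y z x2;
    rewrite -[RHS]mul1r -x2; ring.
Qed.

Hypothesis finXt : locally_finite.

Lemma finite_adjacent s : Xt s -> finite_set [set s' | Xt s' /\ adjacent s s'].
Proof.
move=> Ks.
pose cof := [set t | Xt t /\ (s `<=` t)%fset].
pose fac := [set r | Xt r /\ (r `<=` s)%fset].
have finsub t : finite_set [set r | (r `<=` t)%fset].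
  have -> : [set r | (r `<=` t)%fset] = [set` fpowerset t].
    by apply/seteqP; split=> r /=; rewrite fpowersetE.
  exact: finite_fset.
apply: (@sub_finite_set _ _ (\bigcup_(t in cof) [set r | (r `<=` t)%fset] `|`
   \bigcup_(r in fac) [set t | Xt t /\ (r `<=` t)%fset])).
  move=> s' [Ks' [r Kr /orP[|]/andP[rs rs']]]; [left|right].
  - by exists r.
  - by exists r.
rewrite finite_setU; split; apply: bigcup_finite => //.
- exact: finXt.
- by apply: sub_finite_set (finsub s) => r [].
- by move=> r [Kr _]; exact: finXt.
Qed.

Definition nbrs q s : {fset {fset W}} :=
  fset_set [set s' | faces Xt q.+1 s' /\ adjacent s s'].

Lemma finite_nbrs q s : Xt s ->
  finite_set [set s' | faces Xt q.+1 s' /\ adjacent s s'].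
Proof. by move=> /finite_adjacent; apply: sub_finite_set => s' [[]]. Qed.

Lemma mem_nbrs q s s' : Xt s -> faces Xt q.+1 s' ->
  (s' \in nbrs q s) = `[< adjacent s s' >].
Proof.
move=> Ks Fs'; rewrite in_fset_set; last exact: finite_nbrs.
by apply/idP/asboolP => [/set_mem[]//|adj]; apply/mem_set.
Qed.

Lemma nbrs_faces q s s' : Xt s -> s' \in nbrs q s -> faces Xt q.+1 s'.
Proof.
by move=> Ks; rewrite in_fset_set; [move=> /set_mem[]|exact: finite_nbrs].
Qed.

Lemma laplacianE o q f s : faces Xt q.+1 s ->
  laplacian Xt o q f s = \sum_(s' <- nbrs q s) lap_coef o q s s' * f s'.
Proof.
move=> [Ks cs]; rewrite /laplacian /codifferential /coboundary.
under [RHS]eq_bigr do rewrite mulrDl.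
rewrite big_split/=; congr (_ + _).
  rewrite (@fsum_swap _ _ _ _ [set t | faces Xt q.+2 t /\ (s `<=` t)%fset] _
    [set s' | faces Xt q.+1 s' /\ adjacent s s'])//.
  - by apply: sub_finite_set (finXt Ks) => t [[]].
  - exact: finite_nbrs.
  - by move=> t [].
  - by move=> t [].
  - by move=> t Ft nt; apply: incidence_eq0; apply/negP => st; apply: nt.
  - move=> t s' [[Kt _] st] Fs' ns'; apply: incidence_eq0; apply/negP => s't.
    by apply: ns'; split=> //; exists t => //; rewrite st s't.
rewrite (@fsum_swap _ _ _ _ [set t | faces Xt q t /\ (t `<=` s)%fset] _
    [set s' | faces Xt q.+1 s' /\ adjacent s s'])//.
- apply: (@sub_finite_set _ _ [set` fpowerset s]); last exact: finite_fset.
  by move=> t [_]; rewrite /= fpowersetE.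
- exact: finite_nbrs.
- by move=> t [].
- by move=> t [].
- by move=> t Ft nt; apply: incidence_eq0; apply/negP => st; apply: nt.
- move=> t s' [[Kt _] st] Fs' ns'; apply: incidence_eq0; apply/negP => s't.
  by apply: ns'; split=> //; exists t => //; rewrite st s't orbT.
Qed.

End Laplacian.

(** * Pulling back along a covering *)

Section Quotient.
Context {R : realType} {n : nat} {W V : choiceType}.
Context {Xt : simplicial_complex W} {act : 'rV[int]_n -> W -> W}.
Context {X : simplicial_complex V} {G : {pred 'rV[int]_n}} {p : W -> V}.
Hypothesis hact : free_simplicial_action Xt act.
Hypothesis hp : quotient_map Xt act G X p.
Implicit Types (s t : {fset W}) (g : 'rV[int]_n).

Definition proj_simplex s : {fset V} := [fset p x | x in s]%fset.

Lemma act_simplexD g h s :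
  act_simplex act (g + h) s = act_simplex act g (act_simplex act h s).
Proof.
apply/fsetP => y; apply/imfsetP/imfsetP => /= -[x xs ->].
  by exists (act h x); rewrite ?in_imfset//= (act_comp hact).
by move: xs => /imfsetP[/= z zs ->]; exists z; rewrite ?(act_comp hact).
Qed.

Lemma act_simplex0 s : act_simplex act 0 s = s.
Proof.
apply/fsetP => y; apply/imfsetP/idP => /= [[x xs ->]|ys].
  by rewrite (act_id hact).
by exists y; rewrite ?(act_id hact).
Qed.

Lemma act_simplexK g : cancel (act_simplex act g) (act_simplex act (- g)).
Proof. by move=> s; rewrite -act_simplexD addNr act_simplex0. Qed.

Lemma act_simplexNK g : cancel (act_simplex act (- g)) (act_simplex act g).
Proof. by move=> s; rewrite -act_simplexD subrr act_simplex0. Qed.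

Lemma act_inj g : injective (act g).
Proof.
move=> x y /(congr1 (act (- g))).
by rewrite -!(act_comp hact) addNr !(act_id hact).
Qed.

Lemma act_simplex_faces g s k : faces Xt k s -> faces Xt k (act_simplex act g s).
Proof.
move=> [Ks cs]; split; first exact: (act_simplicial hact).
by rewrite card_imfset//; exact: act_inj.
Qed.

Lemma act_simplex_eq g h s : Xt s ->
  act_simplex act g s = act_simplex act h s -> g = h.
Proof.
move=> Ks /(congr1 (act_simplex act (- h))); rewrite act_simplexK -act_simplexD.
by move=> /(act_free hact Ks)/eqP; rewrite addrC subr_eq0 => /eqP.
Qed.

Lemma faces_neq0 (U : choiceType) (K : simplicial_complex U) k (s : {fset U}) :
  faces K k s -> s != fset0.
Proof. by move=> [Ks _]; apply/eqP => s0; apply: (@simplex_neq0 _ K); rewrite -s0. Qed.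

Lemma proj_act g s : Xt s -> g \in G ->
  proj_simplex (act_simplex act g s) = proj_simplex s.
Proof.
move=> Ks Gg; apply/esym/(quot_fiber hp) => //; last by exists g.
exact: (act_simplicial hact).
Qed.

Lemma proj_faces k s : faces Xt k s -> faces X k (proj_simplex s).
Proof.
move=> [Ks cs]; split; first exact: (quot_simplicial hp).
by rewrite card_in_imfset//; exact: (quot_inj hp).
Qed.

Lemma proj_fiber s s' : Xt s -> Xt s' -> proj_simplex s = proj_simplex s' ->
  exists2 g, g \in G & s' = act_simplex act g s.
Proof. by move=> Ks Ks' /(quot_fiber hp Ks Ks'). Qed.

(** The two lifts differ by some g in G. Then s and its translate by g are faces of t2 with the same
    projection, hence equal, and g = 0 by freeness. *)
Lemma lift_unique s t1 t2 : Xt s -> Xt t1 -> Xt t2 ->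
  (s `<=` t1)%fset -> (s `<=` t2)%fset ->
  proj_simplex t1 = proj_simplex t2 -> t1 = t2.
Proof.
move=> Ks K1 K2 s1 s2 /(proj_fiber K1 K2)[g Gg e].
have /(act_free hact Ks) g0 : act_simplex act g s = s.
  apply: (imfset_inj_sub (quot_inj hp K2)) => //.
    by rewrite e; exact: imfset_sub.
  exact: proj_act.
by rewrite e g0 act_simplex0.
Qed.

Lemma lift_face t (s' : {fset V}) : (s' `<=` proj_simplex t)%fset ->
  exists2 s, (s `<=` t)%fset & proj_simplex s = s'.
Proof.
move=> s't; exists [fset x in t | p x \in s']%fset.
  by apply/fsubsetP => x; rewrite !inE => /andP[].
apply/fsetP => y; apply/imfsetP/idP => /= [[x /[!inE] /andP[_ ?] -> //]|ys'].
have /imfsetP[/= x xt yx] := fsubsetP s't y ys'.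
by exists x => //; rewrite !inE xt -yx.
Qed.

Lemma proj_neq0 s : proj_simplex s != fset0 -> s != fset0.
Proof. by apply: contra_neq => ->; rewrite /proj_simplex imfset0. Qed.

(** Lift t' arbitrarily; the face of the lift over the projection of s is a translate of s, and
    translating back gives a lift that contains s. *)
Lemma lift_coface s (t' : {fset V}) : Xt s -> X t' ->
  (proj_simplex s `<=` t')%fset ->
  exists t, [/\ Xt t, (s `<=` t)%fset & proj_simplex t = t'].
Proof.
move=> Ks /(quot_surj hp)[t0 K0 <-] /lift_face[s0 s0t0 es].
have s00 : s0 != fset0.
  apply: proj_neq0; rewrite es; apply/eqP => e0.
  by apply: (@simplex_neq0 _ X); rewrite -e0; exact: (quot_simplicial hp).
have [g Gg e] := proj_fiber (simplex_face K0 s0t0 s00) Ks es.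
exists (act_simplex act g t0); split.
- exact: (act_simplicial hact).
- by rewrite e; exact: imfset_sub.
- exact: proj_act.
Qed.

(** The projection maps the faces of t bijectively to those of its image and preserves incidence
    numbers when the numbering is lifted. *)
Lemma coboundary_pull (o : V -> nat) k (h : {fset V} -> R) t :
  Xt t ->
  coboundary Xt (o \o p) k (h \o proj_simplex) t =
  coboundary X o k h (proj_simplex t).
Proof.
move=> Kt; rewrite /coboundary.
rewrite -(fsbig_widen [set s | faces Xt k s /\ (s `<=` t)%fset]); first last.
- move=> s [Fs nst] /=; rewrite incidence_eq0 ?mul0r//.
  by apply/negP => st; apply: nst.
- by move=> s [].
rewrite -(fsbig_widen [set s' | faces X k s' /\ (s' `<=` proj_simplex t)%fset]).
- rewrite (@reindex_fsbig _ _ _ _ _ proj_simplex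
    [set s | faces Xt k s /\ (s `<=` t)%fset]).
    apply: eq_fsbigr => s /set_mem[_ st] /=.
    by rewrite incidence_imfset//; exact: (quot_inj hp).
  split.
  + by move=> s [Fs st]; split; [exact: proj_faces|exact: imfset_sub].
  + move=> s1 s2 /set_mem[_ s1t] /set_mem[_ s2t].
    exact: (imfset_inj_sub (quot_inj hp Kt)).
  + move=> s' [Fs' /[dup] s't /lift_face[s st es]]; exists s => //; split=> //.
    have Ks : Xt s.
      by apply: simplex_face Kt st _; apply: proj_neq0; rewrite es (faces_neq0 Fs').
    split=> //; rewrite -Fs'.2 -es card_in_imfset//; exact: (quot_inj hp).
- by move=> s [].
- move=> s [Fs nst] /=; rewrite incidence_eq0 ?mul0r//.
  by apply/negP => st; apply: nst.
Qed.

(** The same for cofaces: [lift_coface] gives surjectivity and [lift_unique] injectivity. *)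
Lemma codifferential_pull (o : V -> nat) k (h : {fset V} -> R) s :
  Xt s ->
  codifferential Xt (o \o p) k (h \o proj_simplex) s =
  codifferential X o k h (proj_simplex s).
Proof.
move=> Ks; rewrite /codifferential.
rewrite -(fsbig_widen [set t | faces Xt k.+1 t /\ (s `<=` t)%fset]); first last.
- move=> t [Ft nst] /=; rewrite incidence_eq0 ?mul0r//.
  by apply/negP => st; apply: nst.
- by move=> t [].
rewrite -(fsbig_widen [set t' | faces X k.+1 t' /\ (proj_simplex s `<=` t')%fset]).
- rewrite (@reindex_fsbig _ _ _ _ _ proj_simplex
    [set t | faces Xt k.+1 t /\ (s `<=` t)%fset]).
    apply: eq_fsbigr => t /set_mem[[Kt _] st] /=.
    by rewrite incidence_imfset//; exact: (quot_inj hp).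
  split.
  + by move=> t [Ft st]; split; [exact: proj_faces|exact: imfset_sub].
  + move=> t1 t2 /set_mem[[K1 _] st1] /set_mem[[K2 _] st2].
    exact: (lift_unique Ks).
  + move=> t' [Ft' st']; have [t [Kt st et]] := lift_coface Ks Ft'.1 st'.
    exists t => //; split=> //; split=> //.
    rewrite -Ft'.2 -et card_in_imfset//; exact: (quot_inj hp).
- by move=> t [].
- move=> t [Ft nst] /=; rewrite incidence_eq0 ?mul0r//.
  by apply/negP => st; apply: nst.
Qed.

Lemma laplacian_pull (o : V -> nat) q (h : {fset V} -> R) s : Xt s ->
  laplacian Xt (o \o p) q (h \o proj_simplex) s =
  laplacian X o q h (proj_simplex s).
Proof.
move=> Ks; rewrite /laplacian -codifferential_pull// -coboundary_pull//.
congr (_ + _); apply: eq_fsbigr => t /set_mem[Kt _] /=.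
  by rewrite coboundary_pull.
by rewrite codifferential_pull.
Qed.

End Quotient.
Arguments proj_simplex {W V} p s.

Lemma quotient_locally_finite {n} {W : choiceType} {V : finType}
    {Xt : simplicial_complex W} {act : 'rV[int]_n -> W -> W}
    {X : simplicial_complex V} {G : {pred 'rV[int]_n}} {p : W -> V} :
  free_simplicial_action Xt act -> quotient_map Xt act G X p ->
  locally_finite Xt.
Proof.
move=> hact hp s Ks.
rewrite -(eq_finite_set (@inj_card_eq _ _ _ (proj_simplex p) _)) //.
  exact: finite_finset.
move=> t1 t2 /set_mem[K1 st1] /set_mem[K2 st2].
exact: (lift_unique hact hp Ks).
Qed.

(** * Finitely supported harmonic cochains *)

Lemma finite_support_asummable {R : realType} {T : choiceType} (A : {fset T})
    (u : T -> R) : (forall t, t \notin A -> u t = 0) -> asummable u.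
Proof.
move=> u0; rewrite /asummable /summable.
rewrite (@eq_esum _ _ _ _ (fun t => if t \in [set` A] then `|(u t)%:E|%E else 0%E)).
  rewrite -esum_mkcond esum_fset// fsbig_finite//=.
  by rewrite set_fsetK sumEFin ltry.
move=> t _; case: ifPn => // /negP tA; rewrite u0 ?abse0//.
by apply/negP => tA'; apply: tA; apply/mem_set.
Qed.

Section Harmonic.
Context {R : realType} {W : choiceType} {Xt : simplicial_complex W}.
Hypothesis finXt : locally_finite Xt.
Variables (o : W -> nat) (q : nat).
Implicit Types f h : {fset W} -> R.

Local Notation H := (l2_harmonic (R := R) Xt o q).

Lemma l2_harmonic_sq f : H f -> sq_summable f.
Proof. by move=> [[]]. Qed.

Lemma l2_harmonic0 : H (fun=> 0).
Proof.
split=> [|s Fs]; last first.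
  by rewrite (laplacianE finXt)// big1// => s' _; rewrite mulr0.
split=> //; apply: (@finite_support_asummable _ _ fset0) => t _.
by rewrite expr0n.
Qed.

Lemma l2_harmonic_lin (c : R) f h : H f -> H h -> H (fun t => f t + c * h t).
Proof.
move=> [[f0 sf] Lf] [[h0 sh] Lh]; split.
  split=> [t nt|]; first by rewrite f0// h0// mulr0 addr0.
  by apply: sq_summableD => //; exact: sq_summableZ.
move=> s Fs; rewrite (laplacianE finXt)//.
under eq_bigr do rewrite mulrDr mulrCA.
by rewrite big_split/= -mulr_sumr -!(laplacianE finXt)// Lf// Lh// mulr0 addr0.
Qed.

(** The Laplacian at s involves finitely many values, so a uniform error e changes it by at most a
    constant times e. *)
Lemma l2_harmonic_closed f : sq_summable f ->
  (forall e : R, 0 < e -> exists2 h, H h & forall t, `|f t - h t| <= e) -> H f.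
Proof.
move=> sf approx.
have small0 (x C : R) : 0 <= C -> (forall e, 0 < e -> `|x| <= C * e) -> x = 0.
  move=> C0 xC; apply/eqP; rewrite -normr_le0; apply/ler_addgt0Pl => e e0.
  rewrite addr0; have C1 : 0 < C + 1 by lra.
  apply: le_trans (xC (e / (C + 1)) _) _; first exact: divr_gt0.
  by rewrite mulrA ler_pdivrMr//; nra.
split; [split=> // t nt|move=> s Fs].
  apply: (small0 _ 1) => // e /approx[h [[h0 _] _] fh].
  by have := fh t; rewrite h0// subr0 mul1r.
apply: (small0 _ (\sum_(s' <- nbrs Xt q s) `|lap_coef Xt o q s s'|)).
  exact: sumr_ge0.
move=> e /approx[h [_ Lh] fh].
have -> : laplacian Xt o q f s = laplacian Xt o q f s - laplacian Xt o q h s.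
  by rewrite Lh// subr0.
rewrite !(laplacianE finXt)// -sumrB.
apply: (le_trans (ler_norm_sum _ _ _)); rewrite mulr_suml.
by apply: ler_sum => s' _; rewrite -mulrBr normrM ler_wpM2l.
Qed.

End Harmonic.

Section VanishingBetti.
Context {R : realType} {n : nat} {W : choiceType} {V : finType}.
Context {Xt : simplicial_complex W} {act : 'rV[int]_n -> W -> W}.
Context {X : simplicial_complex V} {p : W -> V}.
Hypothesis hact : free_simplicial_action Xt act.
Hypothesis hp : quotient_map Xt act predT X p.
Implicit Types (o : W -> nat) (f : {fset W} -> R) (q : nat).

Let finXt : locally_finite Xt := quotient_locally_finite hact hp.

(** Orbits are fibres over simplices of X. Finiteness keeps the sum in [vn_dim] from taking the
    default value 0 of an infinite sum. *)
Lemma finite_orbits k : finite_set (orbits act (faces Xt k)).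
Proof.
apply: (@sub_finite_set _ _
  ((fun r => [set s | Xt s /\ proj_simplex p s = r]) @` [set: {fset V}])).
  move=> _ [s [Ks cs] <-]; exists (proj_simplex p s) => //.
  apply/seteqP; split=> [s' [Ks' /esym es']|_ [g _ <-]] /=.
    by have [g _ ->] := proj_fiber hp Ks Ks' es'; exists g.
  by split; [exact: (act_simplicial hact)|exact: (proj_act hact hp)].
by apply: finite_image; exact: finite_finset.
Qed.

(** A translation is a covering with trivial group, so the results on pullbacks also give the
    equivariance of the Laplacian. *)
Lemma act_quotient_map g : quotient_map Xt act (pred1 0) Xt (act g).
Proof.
split.
- by move=> s; exact: (act_simplicial hact).
- by move=> s _ x y _ _; exact: (act_inj hact).
- move=> t Kt; exists (act_simplex act (- g) t).
    exact: (act_simplicial hact).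
  exact: (act_simplexNK hact).
- move=> s s' Ks Ks'; split=> [e|[h] /[!inE] /eqP -> ->].
    exists 0; rewrite ?inE// (act_simplex0 hact).
    by have := congr1 (act_simplex act (- g)) e; rewrite !(act_simplexK hact).
  by rewrite (act_simplex0 hact).
Qed.

Lemma proj_vertex_act g w : p (act g w) = p w.
Proof.
have := proj_act hact hp (simplex_vertex Xt w) (isT : g \in predT).
by rewrite /proj_simplex /act_simplex !imfset_fset1 => /fset1_inj.
Qed.

Lemma l2_harmonic_act (o : V -> nat) q g f :
  l2_harmonic Xt (o \o p) q f ->
  l2_harmonic Xt (o \o p) q (f \o act_simplex act g).
Proof.
move=> [[f0 sf] Lf]; split; last first.
  move=> s Fs.
  have -> : o \o p = (o \o p) \o act g.
    by apply/funext => w /=; rewrite proj_vertex_act.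
  have := laplacian_pull hact (act_quotient_map g) (o \o p) q f Fs.1.
  by move=> ->; apply: Lf; exact: (act_simplex_faces hact).
split=> [t nt|].
  apply: f0 => Ft; apply: nt; rewrite -(act_simplexK hact g t).
  exact: (act_simplex_faces hact).
move: sf; rewrite /summable (@reindex_esum _ _ _ [set: _] _ (act_simplex act g))//.
split=> //.
- by move=> s t _ _; exact: (can_inj (act_simplexK hact g)).
- by move=> t _; exists (act_simplex act (- g) t) => //; exact: (act_simplexNK hact).
Qed.

(** The von Neumann dimension is a finite sum of nonnegative terms, so each of them is 0 and
    harmonic cochains vanish at the chosen representatives. Translating the cochain extends this to
    every simplex. *)
Lemma l2_betti0_harmonic (o : V -> nat) q : l2_betti R Xt act (o \o p) q = 0 ->
  forall f, l2_harmonic Xt (o \o p) q f -> forall s, f s = 0.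
Proof.
move=> b0 f Hf s; have [Fs|nFs] := pselect (faces Xt q.+1 s); last first.
  exact: Hf.1.1.
set O := [set act_simplex act g s | g in [set: 'rV[int]_n]].
have OO : orbits act (faces Xt q.+1) O by exists s.
have proj_ge0 := inner_orth_proj_ge0 (@l2_harmonic_sq R W Xt (o \o p) q)
  (l2_harmonic0 finXt (o \o p) q) (@l2_harmonic_lin R W Xt finXt (o \o p) q)
  (@l2_harmonic_closed R W Xt finXt (o \o p) q).
have : O (xget fset0 O).
  by apply: (@xgetI _ _ _ s); exists 0; rewrite ?(act_simplex0 hact).
move=> [g _ e].
have -> : f s = (f \o act_simplex act (- g)) (xget fset0 O).
  by rewrite /= -e (act_simplexK hact).
apply: (proj_ge0 (xget fset0 O)).2; last exact: l2_harmonic_act.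
move: b0; rewrite /l2_betti /vn_dim => /eqP.
move/eqP/pfsumr_eq0; apply => //; first exact: finite_orbits.
by move=> ? _; exact: (proj_ge0 _).1.
Qed.

(** The signs of the inversions turn a cochain harmonic for o' into one harmonic for the orientation
    of the hypothesis. A separate o' is allowed because the numbering lifted from a finite cover
    need not be invariant under all of Z^n. *)
Lemma finite_support_harmonic_eq0 (o : V -> nat) o' q (A : {fset {fset W}}) f :
  injective o -> (forall t, Xt t -> {in t &, injective o'}) ->
  l2_betti R Xt act (o \o p) q = 0 ->
  (forall s, s \notin A -> f s = 0) ->
  (forall s, ~ faces Xt q.+1 s -> f s = 0) ->
  (forall s, faces Xt q.+1 s -> laplacian Xt o' q f s = 0) ->
  forall s, f s = 0.
Proof.
move=> oI o'I b0 fA f0 Lf s.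
have opI t : Xt t -> {in t &, injective (o \o p)}.
  by move=> Kt x y xt yt /oI; exact: (quot_inj hp Kt).
pose sgn s : R := (-1) ^+ inversions (o \o p) o' s.
have : sgn s * f s = 0.
  apply: (l2_betti0_harmonic b0 (f := fun s => sgn s * f s)); split.
    split=> [t /f0 ->|]; first by rewrite mulr0.
    apply: (@finite_support_asummable _ _ A) => t /fA ->.
    by rewrite mulr0 expr0n.
  move=> t Ft; rewrite (laplacianE finXt)//.
  rewrite big_seq (eq_bigr (fun s' => sgn t * (lap_coef Xt o' q t s' * f s'))).
    by rewrite -big_seq -mulr_sumr -(laplacianE finXt)// Lf// mulr0.
  move=> s' /(nbrs_faces finXt Ft.1)[Ks' _].
  rewrite (@lap_coef_reorient _ _ _ (o \o p) o')//; last exact: Ft.1.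
  have := sqrr_sign R (inversions (o \o p) o' s'); rewrite -/(sgn t) -/(sgn s').
  move: (sgn t) (sgn s') (lap_coef _ _ _ _ _) => x y c y2.
  by transitivity (x * c * f s' * y ^+ 2); [|rewrite y2]; ring.
by move=> /eqP; rewrite mulf_eq0 signr_eq0 => /eqP.
Qed.

End VanishingBetti.

(** * Ranks *)

Lemma fsum_faces {R : idomainType} {V : finType} (K : simplicial_complex V) k
    (F : {fset V} -> R) :
  \sum_(t \in faces K k) F t = \sum_(i < #|face_pred K k|) F (enum_val i).
Proof.
rewrite -(big_enum_val (A := face_pred K k)) -big_enum/= [RHS]fsbig_seq ?enum_uniq//.
apply: eq_fsbigl; apply/seteqP; split=> t /=; rewrite mem_enum.
  by move=> Ft; apply/mem_set.
by move=> /set_mem.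
Qed.

Lemma ratr_incidence {R : realType} {V : choiceType} (o : V -> nat) t s :
  ratr (incidence rat o t s) = incidence R o t s.
Proof.
by rewrite /incidence rmorph_sum/=; apply: eq_bigr => v _; rewrite rmorph_sign.
Qed.

Section FiniteComplex.
Context {R : realType} {V : finType} (K : simplicial_complex V) (q : nat).
Local Notation k := #|face_pred K q.+1|.

Definition lap_mx : 'M[R]_k := \matrix_(i, j)
  lap_coef K (@vertex_rank V) q (enum_val i) (enum_val j).

(** With boundary matrices A and B, the Laplacian is B^T B + A A^T, of rank at most rank A + rank B,
    whereas b_q = k - rank A - rank B. Ranks are the same over the rationals and over R. *)
Lemma betti_le : (betti K q <= k - \rank lap_mx)%N.
Proof.
set A := boundary_mx K q; set B := boundary_mx K q.+1.
have -> : lap_mx = map_mx ratr (B^T *m B + A *m A^T).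
  apply/matrixP => i j; rewrite !mxE /lap_coef !fsum_faces rmorphD/= !rmorph_sum/=.
  by congr (_ + _); apply: eq_bigr => t _; rewrite !mxE rmorphM/= !ratr_incidence.
rewrite mxrank_map /betti mxrank_ker -subnDA leq_sub2l// addnC.
apply: leq_trans (mxrank_add _ _) _.
by apply: leq_add; [exact: mxrankM_maxr|exact: mxrankM_maxl].
Qed.

Lemma laplacian_mx (u : 'rV[R]_k) (j : 'I_k) : u *m lap_mx = 0 ->
  laplacian K (@vertex_rank V) q
    (fun s => \sum_i u 0 i * (s == enum_val i)%:R) (enum_val j) = 0.
Proof.
move=> uL; transitivity ((u *m lap_mx) 0 j); last by rewrite uL mxE.
rewrite [RHS]mxE; have Fj : faces K q.+1 (enum_val j) by apply/set_mem; exact: enum_valP.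
have finK : locally_finite K by move=> s _; exact: finite_finset.
rewrite (laplacianE finK)//.
transitivity (\sum_(s \in faces K q.+1) lap_coef K (@vertex_rank V) q (enum_val j) s *
    (\sum_i u 0 i * (s == enum_val i)%:R : R)).
  rewrite -(fsbig_widen [set` nbrs K q (enum_val j)]).
  - by rewrite [LHS]fsbig_seq.
  - by move=> s; exact: (nbrs_faces finK Fj.1).
  - move=> s [Fs /negP ns] /=; rewrite lap_coef_eq0 ?mul0r//.
    by move: ns; rewrite (mem_nbrs finK Fj.1)// => /asboolPn.
rewrite fsum_faces; apply: eq_bigr => i _; rewrite !mxE (bigD1 i)//= eqxx mulr1.
rewrite big1 ?addr0 1?lap_coefC 1?mulrC// => i' i'i.
by rewrite (inj_eq enum_val_inj) eq_sym (negbTE i'i) mulr0.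
Qed.

End FiniteComplex.

(** * Restrictions to a window *)

Section WindowRank.
Context {F : fieldType}.

Lemma row_free_rowsub {m n r : nat} (g : 'I_m -> 'I_n) (B : 'M[F]_(n, r)) :
  injective g -> row_free B -> row_free (rowsub g B).
Proof.
move=> gI /row_freeP[C BC]; apply/row_freeP.
exists (C *m (rowsub g 1%:M)^T).
rewrite rowsubE -mulmxA (mulmxA B) BC mul1mx.
apply/matrixP => i j; rewrite !mxE (bigD1 (g i))//= !mxE eqxx mul1r.
rewrite big1 ?addr0; first by rewrite (inj_eq gI) eq_sym.
by move=> l lg; rewrite !mxE eq_sym (negbTE lg) mul0r.
Qed.

(* The restrictions to the window of the rows of M form a matrix P with A P = 0,
   so that rank P <= #|Ib| - #|Is|, whereas the columns b j in the window are
   independent columns of P. *)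
Lemma window_rank {r k : nat} {Ib Is : finType} (M : 'M[F]_(r, k)) (b : 'I_r -> 'I_k)
    (pr : Ib -> 'I_k) (A : Is -> Ib -> F) :
  row_free (rowsub b M^T) ->
  (forall v : Is -> F, (forall t, \sum_s v s * A s t = 0) -> forall s, v s = 0) ->
  (forall i s, \sum_t A s t * M i (pr t) = 0) ->
  (#|[set j | b j \in codom pr]%SET| <= #|Ib| - #|Is|)%N.
Proof.
move=> bM A_inj MA.
pose Am : 'M[F]_(#|Is|, #|Ib|) := \matrix_(s, t) A (enum_val s) (enum_val t).
pose P : 'M[F]_(#|Ib|, r) := \matrix_(t, i) M i (pr (enum_val t)).
have Afree : row_free Am.
  rewrite -kermx_eq0; apply/eqP/row_matrixP => i; rewrite row0.
  set v := row i _.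
  have vA : v *m Am = 0 by apply/sub_kermxP; exact: row_sub.
  apply/rowP => s; rewrite [RHS]mxE -[s]enum_valK.
  apply: (A_inj (fun s => v 0 (enum_rank s))) => t.
  transitivity ((v *m Am) 0 (enum_rank t)); last by rewrite vA mxE.
  rewrite [RHS]mxE.
  rewrite (reindex _ (onW_bij _ (enum_val_bij _)))/=.
  by apply: eq_bigr => s' _; rewrite enum_valK [Am _ _]mxE enum_rankK.
have AP : Am *m P = 0.
  apply/matrixP => s i; rewrite !mxE -[RHS](MA i (enum_val s)).
  rewrite [RHS](reindex _ (onW_bij _ (enum_val_bij _)))/=.
  by apply: eq_bigr => t _; rewrite !mxE.
have := mulmx0_rank_max AP; rewrite (eqP Afree) => rk.
set J := [set j | _]%SET.
suff : (#|J| <= \rank P)%N by move=> /leq_trans; apply; rewrite leq_subRL; lia.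
have lift (j : 'I_#|J|) : exists t : 'I_#|Ib|, pr (enum_val t) = b (enum_val j).
  have := enum_valP j; rewrite inE => /codomP[t ->].
  by exists (enum_rank t); rewrite enum_rankK.
have [g gP] := choice lift.
have <- : \rank (rowsub g P) = #|J|.
  have -> : rowsub g P = rowsub enum_val (rowsub b M^T).
    by apply/matrixP => j i; rewrite !mxE gP.
  by apply/eqP; apply: row_free_rowsub => //; exact: enum_val_inj.
by rewrite rowsubE mxrankM_maxr.
Qed.

End WindowRank.

(** * Boxes *)

Lemma adjacentC {W : choiceType} (Xt : simplicial_complex W) s s' :
  adjacent Xt s s' -> adjacent Xt s' s.
Proof. by move=> [r Kr ss']; exists r => //; rewrite andbC [X in _ || X]andbC. Qed.

Section Window.
Context {R : realType} {W : choiceType} {Xt : simplicial_complex W}.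
Hypothesis finXt : locally_finite Xt.

Lemma laplacian_window {I : finType} (e : I -> {fset W}) o q (f : {fset W} -> R) s :
  injective e -> (forall i, faces Xt q.+1 (e i)) -> faces Xt q.+1 s ->
  (forall s', faces Xt q.+1 s' -> ~ range e s' ->
     lap_coef Xt o q s s' * f s' = 0) ->
  laplacian Xt o q f s = \sum_i lap_coef Xt o q s (e i) * f (e i).
Proof.
move=> eI Fe Fs out; rewrite (laplacianE finXt)// [LHS]fsbig_seq//.
transitivity (\sum_(s' \in faces Xt q.+1) lap_coef Xt o q s s' * f s').
  apply: fsbig_widen => [s'|s' [Fs' /negP ns] /=].
    exact: (nbrs_faces finXt Fs.1).
  rewrite lap_coef_eq0 ?mul0r//.
  by move: ns; rewrite (mem_nbrs finXt Fs.1)// => /asboolPn.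
rewrite -(fsbig_widen (range e)).
- rewrite fsbig_image; last by move=> i j _ _ /eI.
  rewrite -big_enum/= [RHS]fsbig_seq ?enum_uniq//; apply: eq_fsbigl.
  by apply/seteqP; split=> i //= _; rewrite mem_enum.
- by move=> _ [i _ <-].
- by move=> s' [Fs' ns']; exact: out.
Qed.

End Window.

Section Boxes.
Context {n : nat} {W : choiceType} {V : finType}.
Context {Xt : simplicial_complex W} {act : 'rV[int]_n -> W -> W}.
Context {X : simplicial_complex V} {p : W -> V}.
Hypothesis hact : free_simplicial_action Xt act.
Hypothesis hp : quotient_map Xt act predT X p.
Variable q : nat.
Local Notation m := #|face_pred X q.+1|.
Implicit Types (g h x : 'rV[int]_n).

(** Such a system gives every q-simplex of the covering unique coordinates (g, i) in Z^n x 'I_m. *)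
Definition fundamental_simplices (base : 'I_m -> {fset W}) :=
  [/\ forall i, faces Xt q.+1 (base i),
      forall s, faces Xt q.+1 s -> exists g i, s = act_simplex act g (base i) &
      forall i j g h, act_simplex act g (base i) = act_simplex act h (base j) ->
        g = h /\ i = j].

Lemma exists_fundamental_simplices : exists base, fundamental_simplices base.
Proof.
have lift (i : 'I_m) : exists s, faces Xt q.+1 s /\ proj_simplex p s = enum_val i.
  have [Xi ci] : faces X q.+1 (enum_val i) by apply/set_mem; exact: enum_valP.
  have [s Ks es] := quot_surj hp Xi.
  exists s; split=> //; split=> //; rewrite -ci -es card_in_imfset//.
  exact: (quot_inj hp).
have [base baseP] := choice lift; exists base; split.
- by move=> i; exact: (baseP i).1.
- move=> s Fs; have Fps := proj_faces hp Fs.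
  have Ps : proj_simplex p s \in face_pred X q.+1 by apply/mem_set.
  have [g _ ->] : exists2 g, g \in predT &
      s = act_simplex act g (base (enum_rank_in Ps (proj_simplex p s))).
    apply: (proj_fiber hp) => //; [exact: (baseP _).1.1|exact: Fs.1|].
    by rewrite (baseP _).2 enum_rankK_in.
  by exists g, (enum_rank_in Ps (proj_simplex p s)).
- move=> i j g h e; have ij : i = j.
    apply: enum_val_inj; rewrite -!(baseP _).2.
    rewrite -(proj_act hact hp (g := g) (baseP i).1.1)// e.
    by rewrite (proj_act hact hp (baseP j).1.1).
  by split=> //; move: e; rewrite ij; apply: (act_simplex_eq hact (baseP j).1.1).
Qed.

Lemma adjacent_act g s s' : adjacent Xt (act_simplex act g s) s' ->
  adjacent Xt s (act_simplex act (- g) s').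
Proof.
move=> [r Kr ss']; exists (act_simplex act (- g) r).
  exact: (act_simplicial hact).
have sub t t' : (act_simplex act g t `<=` t')%fset ->
    (t `<=` act_simplex act (- g) t')%fset.
  by move=> /(imfset_sub (act (- g))); rewrite -!/(act_simplex _ _ _) (act_simplexK hact).
have sub' t t' : (t' `<=` act_simplex act g t)%fset ->
    (act_simplex act (- g) t' `<=` t)%fset.
  by move=> /(imfset_sub (act (- g))); rewrite -!/(act_simplex _ _ _) (act_simplexK hact).
case/orP: ss' => /andP[h1 h2]; apply/orP; [left|right]; apply/andP; split.
- exact: sub.
- exact: imfset_sub.
- exact: sub'.
- exact: imfset_sub.
Qed.

Variable base : 'I_m -> {fset W}.
Hypothesis baseP : fundamental_simplices base.

(** By equivariance it is enough to look at the neighbours of the finitely many base simplices; d is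
    the largest coordinate that occurs among them. *)
Lemma exists_propagation : exists d : nat, forall i g s', faces Xt q.+1 s' ->
  adjacent Xt (act_simplex act g (base i)) s' ->
  exists h j, s' = act_simplex act (g + h) (base j) /\
    forall a, (`|h ord0 a| <= d)%N.
Proof.
have [Fb cover _] := baseP.
have finXt := quotient_locally_finite hact hp.
have coord s : exists g, faces Xt q.+1 s -> exists i, s = act_simplex act g (base i).
  have [/cover[g [i e]]|nF] := pselect (faces Xt q.+1 s); last by exists 0.
  by exists g => _; exists i.
have [crd crdP] := choice coord.
pose d := (\max_(i < m) \max_(s <- nbrs Xt q (base i)) \max_a `|crd s ord0 a|)%N.
exists d => i g s' Fs' /adjacent_act adj.
set s := act_simplex act (- g) s' in adj.
have Fs : faces Xt q.+1 s by exact: (act_simplex_faces hact).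
have [j sE] := crdP s Fs.
exists (crd s), j; split.
  by rewrite (act_simplexD hact) -sE /s (act_simplexNK hact).
move=> a; apply: leq_trans (leq_bigmax i).
have sN : s \in nbrs Xt q (base i).
  by rewrite (mem_nbrs finXt (Fb i).1)//; apply/asboolP.
rewrite (big_rem s)//=; apply: leq_trans (leq_maxl _ _).
exact: (leq_bigmax a).
Qed.

Definition box_vec {L : nat} (t : {ffun 'I_n -> 'I_L}) : 'rV[int]_n :=
  \row_a (t a : nat)%:Z.

Lemma box_vec_inj L : injective (@box_vec L).
Proof.
move=> t t' /rowP e; apply/ffunP => a; apply: val_inj.
by have := e a; rewrite !mxE => -[].
Qed.

(** The q-simplices over the cube of side L with lowest corner x. *)
Definition box {L : nat} x (t : {ffun 'I_n -> 'I_L} * 'I_m) : {fset W} :=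
  act_simplex act (x + box_vec t.1) (base t.2).

Lemma box_inj L x : injective (@box L x).
Proof.
have [_ _ bI] := baseP.
by move=> [t i] [t' i'] /bI[/addrI /box_vec_inj /= -> /= ->].
Qed.

Lemma box_faces L x t : faces Xt q.+1 (@box L x t).
Proof. by have [Fb _ _] := baseP; exact: (act_simplex_faces hact). Qed.

(** The inner box starts d above the lowest corner in each coordinate and ends d before the opposite
    side, so a displacement of at most d stays in the large box. *)
Lemma box_propagation d L x (t : {ffun 'I_n -> 'I_(L - 2 * d)} * 'I_m) s h j :
  s = act_simplex act (x + const_mx d%:Z + box_vec t.1 + h) (base j) ->
  (forall a, (`|h ord0 a| <= d)%N) -> range (@box L x) s.
Proof.
move=> sE hd.
have bound a : (`|(d%:Z + (t.1 a : nat)%:Z + h ord0 a)%R| < L)%N /\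
    0 <= d%:Z + (t.1 a : nat)%:Z + h ord0 a.
  by have := hd a; have := ltn_ord (t.1 a); lia.
exists ([ffun a => Ordinal (bound a).1], j) => //.
rewrite sE /box/= -!addrA; congr (act_simplex _ (_ + _) _).
apply/rowP => a; rewrite !mxE ffunE/= gez0_abs ?(bound a).2//.
by rewrite addrA.
Qed.

End Boxes.
Arguments fundamental_simplices {n W V} Xt act {X q} base.
Arguments box {n W V} act {X q} base {L} x t.

(** * Counting *)

Section Counting.
Context {R : realType} {n : nat} {W : choiceType} {V V' : finType}.
Context {Xt : simplicial_complex W} {act : 'rV[int]_n -> W -> W}.
Context {X : simplicial_complex V} {p : W -> V}.
Context {G : zmodClosed 'rV[int]_n} {X' : simplicial_complex V'} {p' : W -> V'}.
Hypothesis hact : free_simplicial_action Xt act.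
Hypothesis hp : quotient_map Xt act predT X p.
Hypothesis hp' : quotient_map Xt act G X' p'.
Hypothesis finG : finite_index G.
Variable q : nat.
Hypothesis b0 : l2_betti R Xt act (@vertex_rank V \o p) q = 0.
Local Notation m := #|face_pred X q.+1|.
Local Notation k := #|face_pred X' q.+1|.
Variable base : 'I_m -> {fset W}.
Hypothesis baseP : fundamental_simplices Xt act base.
Variable d : nat.
Hypothesis dP : forall i g s', faces Xt q.+1 s' ->
  adjacent Xt (act_simplex act g (base i)) s' ->
  exists h j, s' = act_simplex act (g + h) (base j) /\
    forall a, (`|h ord0 a| <= d)%N.

Let o' : W -> nat := @vertex_rank V' \o p'.
Let finXt : locally_finite Xt := quotient_locally_finite hact hp.
(** The rows of M are a basis of the harmonic q-cochains of X', and b selects r simplices of X' at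
    which evaluation gives a basis of the dual space. *)
Let r := \rank (kermx (@lap_mx R V' X' q)).
Let M : 'M[R]_(r, k) := row_base (kermx (@lap_mx R V' X' q)).

Let M_full : row_full M^T.
Proof. by rewrite /row_full mxrank_tr; exact: row_base_free. Qed.

Let b : 'I_r -> 'I_k := fullrankfun M_full.

Let M_ker i : row i M *m lap_mx X' q = 0.
Proof.
apply/sub_kermxP; apply: submx_trans (row_sub _ _) _.
by rewrite /M eq_row_base.
Qed.

Let o'_inj t : Xt t -> {in t &, injective o'}.
Proof.
by move=> Kt x y xt yt /val_inj/enum_rank_inj; exact: (quot_inj hp' Kt).
Qed.

(** The matrix A of [window_rank] is the Laplacian from the inner box to the box. Its kernel is 0,
    since an element of it would be a finitely supported harmonic cochain of the covering. *)
Lemma box_rank L x (pr : {ffun 'I_n -> 'I_L} * 'I_m -> 'I_k) :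
  (forall t, enum_val (pr t) = proj_simplex p' (box act base x t)) ->
  (#|[set j | b j \in codom pr]%SET| <= L ^ n * m - (L - 2 * d) ^ n * m)%N.
Proof.
move=> prE.
pose small (s : {ffun 'I_n -> 'I_(L - 2 * d)} * 'I_m) :=
  box act base (x + const_mx d%:Z) s.
have small_inj : injective small by exact: (box_inj baseP).
have small_faces s : faces Xt q.+1 (small s) by exact: (box_faces hact baseP).
have big_faces t : faces Xt q.+1 (box act base x t) by exact: (box_faces hact baseP).
have near_small s s' : faces Xt q.+1 s' -> adjacent Xt (small s) s' ->
    range (fun t : {ffun 'I_n -> 'I_L} * 'I_m => box act base x t) s'.
  by move=> Fs' /(dP Fs')[h [j [e hd]]]; exact: (box_propagation e hd).
have -> : (L ^ n * m - (L - 2 * d) ^ n * m =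
    #|{: {ffun 'I_n -> 'I_L} * 'I_m}| - #|{: {ffun 'I_n -> 'I_(L - 2 * d)} * 'I_m}|)%N.
  by rewrite !card_prod !card_ffun !card_ord.
apply: (@window_rank R r k _ _ M b pr
  (fun s t => lap_coef Xt o' q (small s) (box act base x t))).
- exact: fullrowsub_free.
- move=> v vA s.
  pose f s' : R := \sum_s v s * (s' == small s)%:R.
  have fE s0 : f (small s0) = v s0.
    rewrite /f (bigD1 s0)//= eqxx mulr1 big1 ?addr0// => s1 s10.
    by rewrite (inj_eq small_inj) eq_sym (negbTE s10) mulr0.
  have f0 s' : ~ range small s' -> f s' = 0.
    move=> ns'; rewrite /f big1// => s1 _; case: eqP => [e|]; last by rewrite mulr0.
    by case: ns'; exists s1.
  rewrite -fE; apply: (finite_support_harmonic_eq0 hact hp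
    (A := fset_set (range small)) _ o'_inj b0).
  + by move=> y z /val_inj/enum_rank_inj.
  + move=> s' ns'; apply: f0 => rs'; move: ns'.
    by rewrite in_fset_set ?mem_set//; exact/finite_image/finite_finset.
  + by move=> s' nF; apply: f0 => -[s1 _ e]; apply: nF; rewrite -e.
  + move=> s' Fs'; rewrite (laplacian_window finXt small_inj)//; last first.
      by move=> s1 _ /f0 ->; rewrite mulr0.
    (* At a simplex of the box the Laplacian of f is 0 by [vA]; no other simplex is adjacent to the
       inner box. *)
    have [[t _ <-]|nbig] := pselect
      (range (fun t : {ffun 'I_n -> 'I_L} * 'I_m => box act base x t) s').
      apply: etrans (vA t); apply: eq_bigr => s1 _.
      by rewrite fE mulrC lap_coefC.
    rewrite big1// => s1 _; rewrite lap_coef_eq0 ?mul0r// => /adjacentC.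
    by move=> /near_small; apply: contra_not nbig; apply.
- move=> i s.
  pose h (s' : {fset V'}) : R := \sum_j row i M 0 j * (s' == enum_val j)%:R.
  have hE j : h (enum_val j) = M i j.
    rewrite /h (bigD1 j)//= eqxx mulr1 mxE big1 ?addr0// => j1 j1j.
    by rewrite (inj_eq enum_val_inj) eq_sym (negbTE j1j) mulr0.
  have Ps : proj_simplex p' (small s) \in face_pred X' q.+1.
    by apply/mem_set; exact: (proj_faces hp').
  (* At a simplex of the inner box the Laplacian only sees the box, so harmonicity of the pullback
     of h is the required relation. *)
  have := laplacian_pull hact hp' (@vertex_rank V') q h (small_faces s).1.
  rewrite -[X in laplacian X' _ _ _ X](enum_rankK_in Ps Ps) laplacian_mx ?M_ker//.
  apply: etrans; apply/esym.
  rewrite (@laplacian_window R W Xt finXt _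
    (fun t : {ffun 'I_n -> 'I_L} * 'I_m => box act base x t))//.
  + by apply: eq_bigr => t _; rewrite /= -prE hE.
  + exact: (box_inj baseP).
  + move=> s' Fs' nr; rewrite lap_coef_eq0 ?mul0r// => /(near_small _ _ Fs').
    exact: nr.
Qed.

(** Double counting of the pairs of a coset c and an index j such that the box at a representative
    of c meets b j in X'. [box_rank] bounds the number for each c from above, and each j occurs with
    at least L^n cosets. *)
Lemma box_count L :
  (forall g, g \in G -> (forall a, (`|g ord0 a| < L)%N) -> g = 0) ->
  (r * L ^ n <= subgroup_index G * (L ^ n * m - (L - 2 * d) ^ n * m))%N.
Proof.
move=> embed.
pose T := fset_set (cosets G).
have TP (c : T) : cosets G (val c).
  by have := valP c; rewrite in_fset_set// => /set_mem.
pose rep (c : T) := xget 0 (val c).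
have repP (c : T) : val c (rep c).
  have [x _ xE] := TP c; apply: (@xgetI _ 0 (val c) (x + 0)); rewrite -xE.
  by exists 0 => //; exact: rpred0.
have idx (c : T) (t : {ffun 'I_n -> 'I_L} * 'I_m) : exists j : 'I_k,
    enum_val j = proj_simplex p' (box act base (rep c) t).
  have Ps : proj_simplex p' (box act base (rep c) t) \in face_pred X' q.+1.
    by apply/mem_set; apply: (proj_faces hp'); exact: (box_faces hact baseP).
  exists (enum_rank_in Ps (proj_simplex p' (box act base (rep c) t))).
  by rewrite enum_rankK_in.
pose pr (c : T) := projT1 (choice (idx c)).
have prE (c : T) t : enum_val (pr c t) = proj_simplex p' (box act base (rep c) t).
  exact: projT2 (choice (idx c)) t.
have le_T : (\sum_(c : T) #|[set j | b j \in codom (pr c)]%SET| <=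
    subgroup_index G * (L ^ n * m - (L - 2 * d) ^ n * m))%N.
  have -> : subgroup_index G = #|{: T}| by rewrite -cardfE.
  rewrite -sum_nat_const; apply: leq_sum => c _.
  exact: (box_rank (prE c)).
apply: leq_trans le_T.
have -> : (\sum_(c : T) #|[set j | b j \in codom (pr c)]%SET| =
    \sum_j #|[set c : T | b j \in codom (pr c)]%SET|)%N.
  transitivity (\sum_(c : T) \sum_j (b j \in codom (pr c)))%N.
    by apply: eq_bigr => c _; rewrite -sum1dep_card big_mkcond.
  rewrite [LHS]exchange_big; apply: eq_bigr => j _.
  by rewrite -sum1dep_card [RHS]big_mkcond.
rewrite -[X in (X * _)%N]card_ord -sum_nat_const; apply: leq_sum => j _.
have [X'b cb] : faces X' q.+1 (enum_val (b j)) by apply/set_mem; exact: enum_valP.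
have [s Ks es] := quot_surj hp' X'b.
have Fs : faces Xt q.+1 s.
  by split=> //; rewrite -cb -es card_in_imfset//; exact: (quot_inj hp').
have [_ cover _] := baseP; have [g [i sE]] := cover s Fs.
(* The box with corner g - h contains the lift s of b j, at position h. *)
pose coset (h : {ffun 'I_n -> 'I_L}) : set 'rV[int]_n :=
  [set (g - box_vec h) + z | z in [set` G]].
have cosetT h : coset h \in T by rewrite in_fset_set// mem_set//; exists (g - box_vec h).
pose cos (h : {ffun 'I_n -> 'I_L}) : T := [` cosetT h]%fset.
have cos_inj : injective cos.
  move=> h h' /(congr1 val) /= hh'.
  have : coset h' (g - box_vec h).
    by rewrite -hh'; exists 0; rewrite ?addr0//; exact: rpred0.
  (* Two positions with the same coset differ by an element of G whose coordinates are below L in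
     absolute value, which [embed] forces to be 0. *)
  move=> [z Gz zE]; apply: (@box_vec_inj n L); apply/eqP; rewrite -subr_eq0; apply/eqP.
  have zE' : z = box_vec h' - box_vec h.
    by apply: (addrI (g - box_vec h')); rewrite zE addrA subrK.
  apply: embed; first by rewrite -opprB -zE' rpredN.
  by move=> a; rewrite !mxE; have := ltn_ord (h a); have := ltn_ord (h' a); lia.
have -> : (L ^ n = #|{ffun 'I_n -> 'I_L}|)%N by rewrite card_ffun !card_ord.
rewrite -(card_imset _ cos_inj); apply/subset_leq_card/fintype.subsetP => c.
move=> /finset.imsetP[h _ ->]; rewrite inE; apply/codomP; exists (h, i).
apply: enum_val_inj; rewrite prE -es sE.
(* The chosen representative differs from g - h by some z in G, which the projection to X' does not
   see. *)
have [z Gz zE] := repP (cos h).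
rewrite /box /= -zE; have -> : g - box_vec h + z + box_vec h = z + g.
  by rewrite addrAC subrK addrC.
rewrite (act_simplexD hact) (proj_act hact hp')//.
by rewrite -sE.
Qed.

Lemma betti_box_count L :
  (forall g, g \in G -> (forall a, (`|g ord0 a| < L)%N) -> g = 0) ->
  (betti X' q * L ^ n <= subgroup_index G * (L ^ n * m - (L - 2 * d) ^ n * m))%N.
Proof.
move=> /box_count; apply: leq_trans; rewrite leq_mul2r; apply/orP; right.
by rewrite /r mxrank_ker; exact: betti_le.
Qed.

End Counting.

(** * Word length *)

(** Bounds the shell between two concentric cubes by O(L^n) in dimension n + 1. The subtraction is
    truncated, whence the separate case L <= e. *)
Lemma expn_sub_le L e n : (L ^ n.+1 <= (L - e) ^ n.+1 + n.+1 * e * L ^ n)%N.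
Proof.
elim: n => [|n IH]; first by rewrite !expn1 expn0; lia.
rewrite expnS; apply: leq_trans (leq_mul (leqnn L) IH) _.
have [Le|eL] := leqP L e.
  rewrite (eqP (_ : L - e == 0)%N) ?subn_eq0// !exp0n// !add0n.
  by rewrite mulnCA -expnS leq_mul2r; apply/orP; right; lia.
have le : ((L - e) ^ n.+1 <= L ^ n.+1)%N by rewrite leq_exp2r// leq_subr.
rewrite mulnDr (mulnCA L) -expnS [((L - e) ^ n.+2)%N]expnS.
have : (L * (L - e) ^ n.+1 = (L - e) * (L - e) ^ n.+1 + e * (L - e) ^ n.+1)%N.
  by rewrite -mulnDl subnK// ltnW.
by have := leq_mul (leqnn e) le; lia.
Qed.

Section WordLength.
Context {n : nat} (S : seq 'rV[int]_n).
Hypothesis hS : generates S.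
Implicit Types (g h : 'rV[int]_n) (G : {pred 'rV[int]_n}).

Lemma leastP (A : set nat) : A !=set0 -> A (least A) /\ forall j, A j -> (least A <= j)%N.
Proof.
move=> [k Ak]; rewrite /least.
have exA : exists i, `[< A i >] by exists k; apply/asboolP.
have [i /asboolP Ai min_i] := ex_minnP exA.
apply: (@xgetPex _ 0%N [set k | A k /\ forall j, A j -> (k <= j)%N]).
by exists i; split=> // j Aj; apply: min_i; apply/asboolP.
Qed.

Lemma is_word_length g : is_word S (word_length S g) g.
Proof. by have [] := leastP (hS g). Qed.

Lemma word_length_le k g : is_word S k g -> (word_length S g <= k)%N.
Proof. by move=> w; have [_] := leastP (hS g); apply. Qed.

Lemma word_length0 : word_length S 0 = 0%N.
Proof.
apply/eqP; rewrite -leqn0; apply: word_length_le.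
by exists [tuple]; split=> //; rewrite big_nil.
Qed.

Lemma word_lengthD g h : (word_length S (g + h) <= word_length S g + word_length S h)%N.
Proof.
have [w [wS wE]] := is_word_length g; have [w' [wS' wE']] := is_word_length h.
apply: word_length_le; exists [tuple of w ++ w']; split.
  by move=> x /=; rewrite mem_cat => /orP[/wS|/wS'].
by rewrite /= big_cat/= -wE -wE'.
Qed.

Lemma word_lengthN g : (word_length S (- g) <= word_length S g)%N.
Proof.
have [w [wS wE]] := is_word_length g.
apply: word_length_le; exists [tuple of map -%R w]; split.
  by move=> x /mapP[y /wS ? ->]; rewrite opprK; tauto.
by rewrite /= big_map sumrN [in LHS]wE.
Qed.

Lemma word_length_eq0 g : word_length S g = 0%N -> g = 0.
Proof.
move=> g0; have [w [_ ->]] := is_word_length g; move: w; rewrite g0 => w.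
by rewrite tuple0 big_nil.
Qed.

Lemma word_lengthMn g k : (word_length S (g *+ k) <= k * word_length S g)%N.
Proof.
elim: k => [|k IH]; first by rewrite mulr0n word_length0.
by rewrite mulrS mulSn; apply: leq_trans (word_lengthD _ _) _; rewrite leq_add2l.
Qed.

Lemma word_lengthMz g (z : int) : (word_length S (g *~ z) <= `|z| * word_length S g)%N.
Proof.
case: z => k; first exact: word_lengthMn.
by rewrite NegzE mulrNz; apply: leq_trans (word_lengthN _) _; exact: word_lengthMn.
Qed.

(** Expanding g in the standard basis bounds the word length by a multiple of the sup norm. *)
Lemma word_length_sup g (l : nat) : (forall a, (`|g ord0 a| <= l)%N) ->
  (word_length S g <= l * \sum_a word_length S (delta_mx ord0 a))%N.
Proof.
move=> gl; rewrite [g in X in (X <= _)%N]row_sum_delta.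
apply: (@leq_trans (\sum_a word_length S (g ord0 a *: delta_mx ord0 a))%N).
  elim/big_ind2: _ => [|x x' y y' h1 h2|//]; first by rewrite word_length0.
  by apply: leq_trans (word_lengthD _ _) _; exact: leq_add.
rewrite big_distrr/=; apply: leq_sum => a _.
rewrite -[X in X *: _]intz scaler_int.
by apply: leq_trans (word_lengthMz _ _) _; rewrite leq_mul2r gl orbT.
Qed.

(** A nonzero element of G ensures that [short] is a true minimum and not the default value 0. *)
Lemma short_spec G : (exists2 g, g \in G & g != 0) ->
  (exists2 g, g \in G /\ g != 0 & word_length S g = short S G) /\
  forall g, g \in G -> g != 0 -> (short S G <= word_length S g)%N.
Proof.
pose A := [set word_length S g | g in [set g | g \in G /\ g != 0]].
move=> [g Gg g0]; have [Ash min_sh] : A (short S G) /\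
    forall j, A j -> (short S G <= j)%N.
  by apply: leastP; exists (word_length S g), g.
by split=> // h Gh h0; apply: min_sh; exists h.
Qed.

Lemma short_le G g : g \in G -> g != 0 -> (short S G <= word_length S g)%N.
Proof. by move=> Gg g0; apply: (short_spec _).2 => //; exists g. Qed.

Lemma short_gt0 G : (exists2 g, g \in G & g != 0) -> (0 < short S G)%N.
Proof.
move=> /short_spec[[h [_ h0] <-] _].
by rewrite lt0n; apply: contra_neq h0; exact: word_length_eq0.
Qed.

End WordLength.

(** * Subgroups of finite index and the final estimate *)

(** Otherwise the constant vectors, which are pairwise distinct as n > 0, would lie in infinitely
    many cosets. *)
Lemma finite_index_nontrivial {n : nat} (G : zmodClosed 'rV[int]_n) : (0 < n)%N ->
  finite_index G -> exists2 g, g \in G & g != 0.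
Proof.
move=> n0 finG; apply: contrapT => triv.
have G0 g : g \in G -> g = 0.
  by move=> Gg; apply/eqP; apply/negP => /negP g0; apply: triv; exists g.
pose v (k : nat) : 'rV[int]_n := const_mx k%:Z.
pose c k := [set v k + g | g in [set` G]].
have c_inj : injective c.
  move=> i j e; have : c i (v j) by rewrite e; exists 0; rewrite ?addr0//; exact: rpred0.
  move=> [g /G0 -> /rowP/(_ (Ordinal n0))]; rewrite addr0 !mxE.
  by move=> [].
have : finite_set [set: nat].
  rewrite -(eq_finite_set (@inj_card_eq _ _ _ c _)); last by move=> ? ? _ _ /c_inj.
  by apply: sub_finite_set finG => _ [k _ <-]; exists (v k).
exact: infinite_nat.
Qed.

Lemma betti_mul_short_le {R : realType} {n : nat} (S : seq 'rV[int]_n)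
    {V : finType} {X : simplicial_complex V} {W : choiceType}
    {Xt : simplicial_complex W} {act : 'rV[int]_n -> W -> W} {p : W -> V} q :
  (0 < n)%N -> generates S -> free_simplicial_action Xt act ->
  quotient_map Xt act predT X p ->
  l2_betti R Xt act (@vertex_rank V \o p) q = 0 ->
  exists C : nat, forall (G : zmodClosed 'rV[int]_n), finite_index G ->
    forall (V' : finType) (X' : simplicial_complex V') (p' : W -> V'),
      quotient_map Xt act G X' p' ->
      (0 < short S G)%N /\ (betti X' q * short S G <= C * subgroup_index G)%N.
Proof.
move=> n0 hS hact hp b0.
have [base baseP] := exists_fundamental_simplices hact hp q.
have [d dP] := exists_propagation hact hp baseP.
set m := #|face_pred X q.+1|.
pose c := (\sum_a word_length S (delta_mx ord0 a)).+1.
(* The shell has at most n (2d) L^(n-1) lattice points with m simplices over each, and the factor c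
   passes from L to [short]. None of these numbers depends on G. *)
exists (n * (2 * d) * m * c)%N => G finG V' X' p' hp'.
have [g0 Gg0 g00] := finite_index_nontrivial n0 finG.
have s0 : (0 < short S G)%N by apply: (short_gt0 hS); exists g0.
split=> //; set s := short S G.
(* The largest L with (L - 1) c < s: vectors with coordinates below L have word length less than s,
   so those in G are 0, and still s <= L c. *)
pose L := (s.-1 %/ c).+1.
have embed g : g \in G -> (forall a, (`|g ord0 a| < L)%N) -> g = 0.
  move=> Gg gL; apply/eqP; apply: contraTT isT => gn0.
  have gs : (s <= s.-1)%N.
    apply: leq_trans (short_le S Gg gn0) _.
    apply: leq_trans (word_length_sup hS gL) _.
    by apply: leq_trans (leq_trunc_div s.-1 c); rewrite leq_mul2l leqnSn orbT.
  by move: gs s0; rewrite -/s; case: (s) => // s' /=; rewrite ltnn.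
have sL : (s <= L * c)%N by have := ltn_ceil s.-1 (isT : 0 < c)%N; lia.
have := betti_box_count hact hp hp' finG b0 baseP dP embed.
rewrite -/m -mulnBl => le_box.
have le_shell := expn_sub_le L (2 * d) n.-1; rewrite prednK// in le_shell.
have Ln : (L ^ n = L * L ^ n.-1)%N by rewrite -expnS prednK.
have L0 : (0 < L ^ n.-1)%N by rewrite expn_gt0.
(* Both sides of the count carry a factor L^(n-1), which cancels as L > 0. *)
have le_L : (betti X' q * L <= n * (2 * d) * m * subgroup_index G)%N.
  rewrite -(leq_pmul2r L0) -mulnA -Ln; apply: leq_trans le_box _.
  have : (L ^ n - (L - 2 * d) ^ n <= n * (2 * d) * L ^ n.-1)%N by rewrite leq_subLR.
  move=> /(leq_mul (leqnn (subgroup_index G * m))).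
  by move: (L ^ n - _)%N => x; rewrite !mulnA; lia.
apply: leq_trans (leq_mul (leqnn _) sL) _.
by move: (leq_mul le_L (leqnn c)); rewrite !mulnA; lia.
Qed.

Unset Implicit Arguments.

(* The simplices of the covering are given the orientations lifted from X, by
   numbering its vertices through p; these are invariant under the action. *)
Theorem theorem0p4 (R : realType) (n : nat) (hn : (1 <= n)%N)
    (S : seq 'rV[int]_n) (hS : generates S)
    (V : finType) (X : simplicial_complex V)
    (W : choiceType) (Xt : simplicial_complex W)
    (act : 'rV[int]_n -> W -> W) (hact : free_simplicial_action Xt act)
    (p : W -> V) (hp : quotient_map Xt act predT X p)
    (q : nat)
    (hb : l2_betti R Xt act (fun w => vertex_rank (p w)) q = 0) :
  exists C : R, 0 < C /\
    forall (G : zmodClosed 'rV[int]_n), finite_index G ->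
    forall (V' : finType) (X' : simplicial_complex V') (p' : W -> V'),
      quotient_map Xt act G X' p' ->
      (betti X' q)%:R <= C * ((subgroup_index G)%:R / (short S G)%:R).
Proof.
have [C CP] := betti_mul_short_le hn hS hact hp hb.
(* The natural number C may be 0, while the constant has to be positive. *)
exists (C%:R + 1); split; first by rewrite ltr_wpDl ?ler0n.
move=> G finG V' X' p' hp'; have [s0 le] := CP G finG V' X' p' hp'.
rewrite mulrA ler_pdivlMr ?ltr0n// -natrM.
apply: (@le_trans _ _ (C * subgroup_index G)%:R); first by rewrite ler_nat.
by rewrite natrM ler_wpM2r// lerDl.
Qed.
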